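(* Let $H$ be an infinite-dimensional (complex) Hilbert space. Then there is no locally compact Hausdorff étale groupoid $G$ and no twist $\Sigma$ over $G$ such that $B(H)\cong C_r^*(G,\Sigma)$ (isomorphism of $C^*$-algebras).
   Context: $B(H)$ is the $C^*$-algebra of all bounded operators on $H$. A locally compact Hausdorff étale groupoid $G$ is a topological groupoid with locally compact Hausdorff topology whose range and source maps $r,s:G\to G^{(0)}$ are local homeomorphisms. Write $G^u=r^{-1}(u)$, $G_u=s^{-1}(u)$. A twist over $G$ is a central extension of topological groupoids $G^{(0)}\times\mathbb T\xrightarrow{\iota}\Sigma\xrightarrow{q}G$, where $\mathbb T$ is the unit circle, $\Sigma$ is a locally compact Hausdorff groupoid with unit space identified with $G^{(0)}$, $\iota$ is a homeomorphism onto $q^{-1}(G^{(0)})$, $q$ is a continuous open surjective groupoid homomorphism, $\iota(r(\varsigma),z)\varsigma=\varsigma\,\iota(s(\varsigma),z)=:z\varsigma$ for all $\varsigma\in\Sigma$, $z\in\mathbb T$ (centrality), and $\Sigma\to G$ is a locally trivial principal $\mathbb T$-bundle. $C_c(G,\Sigma)$ is the $*$-algebra of continuous compactly supported functions $f:\Sigma\to\mathbb C$ with $f(z\varsigma)=zf(\varsigma)$ for $z\in\mathbb T$ (sections of the associated line bundle over $G$), with product $(f*g)(\varsigma)=\sum_{q(\tau)\in G^{r(\varsigma)}}f(\tau)g(\tau^{-1}\varsigma)$ (one representative $\tau\in\Sigma$ for each element of $G^{r(\varsigma)}$) and involution $f^*(\varsigma)=\overline{f(\varsigma^{-1})}$.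 For $u\in G^{(0)}$, let $\ell^2(G_u,\Sigma_u)$ be the Hilbert space of functions $h:q^{-1}(G_u)\to\mathbb C$ with $h(z\varsigma)=zh(\varsigma)$ and $\sum_{q(\varsigma)\in G_u}|h(\varsigma)|^2<\infty$; the regular representation $\lambda_u$ of $C_c(G,\Sigma)$ on it is $\lambda_u(f)h=f*h$. The reduced twisted groupoid $C^*$-algebra $C_r^*(G,\Sigma)$ is the completion of $C_c(G,\Sigma)$ in the norm $\|f\|_r=\sup_{u\in G^{(0)}}\|\lambda_u(f)\|$. *)

(* Defs.v *)
From HB Require Import structures.
From mathcomp Require Import all_boot all_order all_algebra sesquilinear.
From mathcomp Require Import complex ring lra.
From mathcomp Require Import all_classical all_reals all_analysis.

Set Implicit Arguments.
Unset Strict Implicit.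
Unset Printing Implicit Defensive.

Import Order.TTheory GRing.Theory Num.Theory numFieldNormedType.Exports.

Local Open Scope classical_set_scope.
Local Open Scope complex_scope.
Local Open Scope ring_scope.

(* [R[i]] with the topology and norm of the numeric field it is. *)
HB.instance Definition _ (R : realType) := NormedModule.copy R[i] R[i]^o.

(* The inner product is linear in its first argument. *)
HB.mixin Record isHilbert (R : realType) H & CompleteNormedModule R[i] H := {
  inner : {dot H for Num.conj};
  sqr_normE : forall x : H, `|x| ^+ 2 = inner x x
}.
#[short(type="hilbertType")]
HB.structure Definition Hilbert (R : realType) :=
  {H of CompleteNormedModule R[i] H & isHilbert R H}.

(* Not necessarily unital, so not built on [algType]. *)
HB.mixin Record isCStarAlgebra (R : realType) A
    & CompleteNormedModule R[i] A := {
  cmul : A -> A -> A;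
  cstar : A -> A;
  cmulA : associative cmul;
  cmulDl : left_distributive cmul +%R;
  cmulDr : right_distributive cmul +%R;
  cmulZl : forall (c : R[i]) (a b : A), cmul (c *: a) b = c *: cmul a b;
  cmulZr : forall (c : R[i]) (a b : A), cmul a (c *: b) = c *: cmul a b;
  cstarK : involutive cstar;
  cstarD : {morph cstar : a b / a + b};
  cstarZ : forall (c : R[i]) (a : A), cstar (c *: a) = Num.conj c *: cstar a;
  cstarM : forall a b : A, cstar (cmul a b) = cmul (cstar b) (cstar a);
  normr_cmul : forall a b : A, `|cmul a b| <= `|a| * `|b|;
  normr_cstar : forall a : A, `|cmul (cstar a) a| = `|a| ^+ 2
}.
#[short(type="cstarAlgebraType")]
HB.structure Definition CStarAlgebra (R : realType) :=
  {A of CompleteNormedModule R[i] A & isCStarAlgebra R A}.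

Section InnerProduct.
Variables (R : realType) (H : hilbertType R).
Implicit Types (x y z : H) (c : R[i]).

Local Notation "''[' u , v ]" := (inner (u : H) (v : H)) : ring_scope.

Lemma innerC x y : '[x, y] = ('[y, x])^*.
Proof. by have := hermC (@inner R H) x y; rewrite expr0 mul1r. Qed.

Lemma innerDl x y z : '[x + y, z] = '[x, z] + '[y, z].
Proof. by rewrite linearDl. Qed.

Lemma innerBl x y z : '[x - y, z] = '[x, z] - '[y, z].
Proof. by rewrite linearBl. Qed.

Lemma innerZl c x y : '[c *: x, y] = c * '[x, y].
Proof. by rewrite linearZl_LR. Qed.

Lemma innerDr x y z : '[x, y + z] = '[x, y] + '[x, z].
Proof. by rewrite linearDr. Qed.

Lemma innerBr x y z : '[x, y - z] = '[x, y] - '[x, z].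
Proof. by rewrite linearBr. Qed.

Lemma innerZr c x y : '[x, c *: y] = c^* * '[x, y].
Proof. by rewrite linearZr_LR. Qed.

Lemma inner_inj x y : (forall z, '[z, x] = '[z, y]) -> x = y.
Proof.
move=> h; apply/eqP; rewrite -subr_eq0 -normr_eq0 -sqrf_eq0 sqr_normE.
by rewrite innerBr h subrr.
Qed.

Lemma inner_ge0 x : 0 <= '[x, x].
Proof. by rewrite -sqr_normE exprn_ge0. Qed.

Lemma cauchy_schwarz x y : `|'[x, y]| <= `|x| * `|y|.
Proof.
have [->|y0] := eqVneq y 0; first by rewrite normr0 linear0r normr0 mulr0.
have n0 : 0 < `|y| ^+ 2 by rewrite exprn_gt0 ?normr_gt0.
have yy0 : '[y, y] != 0 by rewrite -sqr_normE gt_eqF.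
have := inner_ge0 ('[y, y] *: x - '[x, y] *: y).
rewrite innerBl !innerBr !innerZl !innerZr.
have -> : '[y, y]^* = '[y, y] by rewrite -innerC.
rewrite [X in _ - X](_ : _ = 0) ?subr0; last by rewrite (innerC y x); ring.
set u := '[x, y]; rewrite [X in _ <= X](_ : _ = '[y, y] * ('[y, y] * '[x, x] - u * u^*)); last first.
  by ring.
rewrite -sqr_normE pmulr_rge0// subr_ge0 -normCK -!sqr_normE -exprMn mulrC.
by rewrite ler_pXn2r// nnegrE ?mulr_ge0.
Qed.

Lemma parallelogram x y :
  `|x - y| ^+ 2 = 2 * `|x| ^+ 2 + 2 * `|y| ^+ 2 - `|x + y| ^+ 2.
Proof. rewrite !sqr_normE innerBl innerDl !innerBr !innerDr; ring. Qed.

Definition rnorm (x : H) : R := complex.Re `|x|.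

Lemma rnormE x : `|x| = (rnorm x)%:C.
Proof. by rewrite /rnorm RRe_real// normr_real. Qed.

Lemma rnorm_ge0 x : 0 <= rnorm x.
Proof. by rewrite -ler0c -rnormE. Qed.

Lemma gtr0c (k : R) : (0 < k%:C) = (0 < k).
Proof. exact: (ltcR 0 k). Qed.

Lemma le_complexP c (M : R[i]) : 0 <= M ->
  (forall e : R, 0 < e -> c <= M + e%:C) -> c <= M.
Proof.
move=> M0 h; have /complex_realP[m mE] : M \is Num.real by rewrite ger0_real.
have := h 1 ltr01; rewrite mE -rmorphD/= lecE/= => /andP[/eqP i _].
rewrite lecE/= i eqxx/=; apply/ler_addgt0Pr => e e0.
by have := h e e0; rewrite mE -rmorphD/= lecE/= => /andP[].
Qed.

Lemma riesz (phi : H -> R[i]) (M : R[i]) :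
  (forall c x y, phi (c *: x + y) = c * phi x + phi y) ->
  (forall x, `|phi x| <= M * `|x|) -> exists y, forall x, phi x = '[x, y].
Proof.
move=> phiL phiM.
have phi0 : phi 0 = 0.
  by have := phiL (-1) 0 0; rewrite scaler0 add0r mulN1r addNr.
have phiD x y : phi (x + y) = phi x + phi y by have := phiL 1 x y; rewrite scale1r mul1r.
have phiZ c x : phi (c *: x) = c * phi x by have := phiL c x 0; rewrite addr0 phi0 addr0.
have phiB x y : phi (x - y) = phi x - phi y by rewrite phiD -scaleN1r phiZ mulN1r.
have [z0|] := pselect (forall x, phi x = 0).
  by exists 0 => x; rewrite z0 linear0r.
move=> /existsNP[x1 /eqP px1].
pose x0 := (phi x1)^-1 *: x1.
have px0 : phi x0 = 1 by rewrite phiZ mulVf.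
pose S := [set r | exists2 x, phi x = 1 & r = rnorm x].
have Sinf : has_inf S.
  split; first by exists (rnorm x0), x0.
  by exists 0 => _ [x _ ->]; exact: rnorm_ge0.
pose d := inf S.
have dle x : phi x = 1 -> d <= rnorm x.
  by move=> h; apply: ge_inf; [case: Sinf|exists x].
have d0 : 0 <= d by apply: lb_le_inf; [case: Sinf|move=> _ [x _ ->]; exact: rnorm_ge0].
pose A (e : R) := [set x | phi x = 1 /\ rnorm x < d + e].
pose F := filter_from [set e : R | 0 < e] A.
have FF : Filter F.
  apply: filter_from_filter; first by exists 1 => /=.
  move=> i j /= i0 j0; exists (Num.min i j); first by rewrite /= lt_min i0 j0.
  by move=> x [px /= xl]; split; split => //; apply: (lt_le_trans xl);
    rewrite lerD2l ge_min lexx ?orbT.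
have PF : ProperFilter F.
  apply: filter_from_proper => // e /= e0.
  by have [_ [x px ->] xl] := inf_adherent e0 Sinf; exists x.
have Fc : cauchy F.
  apply/cauchyP => e e0.
  have [e' ee'] : exists e', e = e'%:C.
    by apply/complex_realP; rewrite gtr0_real.
  move: e0; rewrite ee' gtr0c => e0.
  pose t := Num.min 1 (e' ^+ 2 / (8 * d + 5)).
  have k0 : 0 < 8 * d + 5 by rewrite ltr_wpDl// mulr_ge0.
  have t0 : 0 < t by rewrite lt_min ltr01 divr_gt0// exprn_gt0.
  have [_ [x px ->] xl] := inf_adherent t0 Sinf.
  exists x; exists t => // y [py yl].
  rewrite -ball_normE/= -(@ltr_pXn2r _ 2)// ?nnegrE ?ler0c ?(ltW e0)//.
  rewrite parallelogram !rnormE.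
  have : d * 2 <= rnorm (x + y).
    have := dle (2^-1 *: (x + y)).
    rewrite phiZ phiD px py.
    have -> : 2^-1 * (1 + 1) = 1 :> R[i] by rewrite mulVf// pnatr_eq0.
    move=> /(_ erefl); rewrite -ler_pdivlMr// => /le_trans; apply.
    rewrite -lecR -rnormE normrZ rnormE mulrC rmorphM/= ler_wpM2l//.
      by rewrite ler0c rnorm_ge0.
    by rewrite fmorphV rmorph_nat ger0_norm ?invr_ge0.
  rewrite -!rmorphXn/= -(rmorph_nat (real_complex R) 2) -!rmorphM/= -rmorphD -rmorphB/= ltcR.
  have := rnorm_ge0 x; have := rnorm_ge0 y.
  set a := rnorm x; set b := rnorm y; set s := rnorm (x + y) => b0 a0 sd.
  have tE : t * (8 * d + 5) <= e' ^+ 2.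
    by rewrite -ler_pdivlMr// ge_min lexx orbT.
  have t1 : t <= 1 by rewrite ge_min lexx.
  have ha : a ^+ 2 <= (d + t) ^+ 2 by rewrite ler_pXn2r ?nnegrE ?(ltW xl) ?addr_ge0 ?(ltW t0).
  have hb : b ^+ 2 <= (d + t) ^+ 2 by rewrite ler_pXn2r ?nnegrE ?(ltW yl) ?addr_ge0 ?(ltW t0).
  have hs : (d * 2) ^+ 2 <= s ^+ 2 by rewrite ler_pXn2r ?nnegrE ?rnorm_ge0 ?mulr_ge0.
  have tt : t ^+ 2 <= t by rewrite expr2 ler_piMl// ltW.
  by nra.
have /cauchy_cvg/cvg_ex[a Fa] := Fc.
have M0 : 0 <= M * `|x0|.
  by apply: le_trans (phiM x0); rewrite px0 normr1.
have near_a (e : R) : 0 < e -> exists x, [/\ phi x = 1, rnorm x < d + e & `|a - x| <= e%:C].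
  move=> e0; have h : \forall x \near F, `|a - x| <= e%:C.
    by apply: ((@cvgrPdist_le _ _ _ F _ idfun a).1 Fa); rewrite gtr0c.
  have h2 : F (A e) by exists e.
  by have [x [[px xl] xa]] := filter_ex (filterI h2 h); exists x.
have pa : phi a = 1.
  apply/eqP; rewrite -subr_eq0 -normr_le0.
  have M0' : 0 <= M.
    have : x0 != 0 by apply: contra_eq_neq px0 => ->; rewrite phi0 eq_sym oner_eq0.
    by rewrite -normr_gt0 => x00; rewrite -(pmulr_lge0 M x00).
  apply: le_complexP => // e e0; rewrite add0r.
  have /complex_realP[m mE] : M \is Num.real by rewrite ger0_real.
  have m0 : 0 <= m by rewrite -ler0c -mE.
  have [] := near_a (e / (m + 1)); first by rewrite divr_gt0// ltr_wpDl.
  move=> x [px _ ax]; rewrite -px -phiB; apply: (le_trans (phiM _)).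
  apply: (@le_trans _ _ (M * (e / (m + 1))%:C)); first by rewrite ler_wpM2l.
  rewrite mE -rmorphM/= lecR mulrCA ler_piMr// ?(ltW e0)//.
  by rewrite ler_pdivrMr ?ltr_wpDl// mul1r lerDl.
have na : rnorm a <= d.
  apply/ler_addgt0Pr => e e0; have [] := near_a (e / 2); first by rewrite divr_gt0.
  move=> x [px xd ax]; rewrite -lecR -rnormE.
  rewrite -[X in `|X|](subrK x); apply: (le_trans (ler_normD _ _)).
  rewrite (rnormE x) rnormE -rmorphD/= lecR.
  have : rnorm (a - x) <= e / 2 by rewrite -lecR -rnormE.
  by lra.
have a0 : '[a, a] != 0.
  rewrite -sqr_normE sqrf_eq0 normr_eq0.
  by apply: contra_eq_neq pa => ->; rewrite phi0 eq_sym oner_eq0.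
have orth v : phi v = 0 -> '[v, a] = 0.
  move=> pv; have [->|v0] := eqVneq v 0; first by rewrite linear0l.
  have vv0 : '[v, v] != 0 by rewrite -sqr_normE sqrf_eq0 normr_eq0.
  pose c := '[a, v] / '[v, v].
  have : `|a| ^+ 2 <= `|a - c *: v| ^+ 2.
    rewrite ler_pXn2r ?nnegrE//= !rnormE lecR (le_trans na)// dle//.
    by rewrite phiB phiZ pv mulr0 subr0.
  rewrite !sqr_normE innerBl !innerBr !innerZl !innerZr.
  have -> : c * '[v, a] = '[a, v] * '[v, a] / '[v, v] by rewrite /c mulrAC.
  have -> : c * (c^* * '[v, v]) = c^* * '[a, v] by rewrite mulrCA divfK.
  rewrite [X in _ <= X](_ : _ = '[a, a] - '[a, v] * '[v, a] / '[v, v]); last by ring.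
  rewrite -subr_ge0 addrAC subrr add0r oppr_ge0 (innerC v a).
  rewrite -normCK -[X in _ / X]sqr_normE pmulr_lle0 ?invr_gt0 ?exprn_gt0 ?normr_gt0//.
  move=> h; have : `|'[a, v]| ^+ 2 == 0 by rewrite eq_le h exprn_ge0.
  by rewrite sqrf_eq0 normr_eq0 => /eqP ->; rewrite rmorph0.
exists ('[a, a]^-1 *: a) => x.
have /orth : phi (x - phi x *: a) = 0 by rewrite phiB phiZ pa mulr1 subrr.
rewrite innerBl innerZl => /eqP; rewrite subr_eq0 => /eqP xa.
by rewrite innerZr fmorphV/= -innerC xa mulrC mulfK.
Qed.

End InnerProduct.

Section BoundedOperators.
Variables (R : realType) (H : hilbertType R).

Definition bounded_linear : {pred H -> H} := fun f =>
  `[< linear f /\ exists M : R[i], forall x, `|f x| <= M * `|x| >].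

Record bounded_operator := BoundedOperator {
  bounded_operator_fun :> H -> H;
  bounded_operatorP : bounded_operator_fun \in bounded_linear }.

HB.instance Definition _ := [isSub for bounded_operator_fun].
HB.instance Definition _ := [Choice of bounded_operator by <:].

Lemma bounded_linear_submod : submod_closed bounded_linear.
Proof.
split=> [|c f g /asboolP[fL [M fM]] /asboolP[gL [N gN]]]; apply/asboolP.
  split=> [a u v|]; first by rewrite scaler0 addr0.
  by exists 0 => x; rewrite normr0 mul0r.
split=> [a u v|].
  rewrite !fctE /= fL gL !scalerDr !scalerA (mulrC c a) -!addrA; congr (_ + _).
  by rewrite addrCA.
exists (`|c| * M + N) => x; rewrite mulrDl (le_trans (ler_normD _ _))// lerD//.
by rewrite normrZ -mulrA ler_wpM2l.
Qed.

HB.instance Definition _ :=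
  GRing.isSubmodClosed.Build R[i] (H -> H) bounded_linear bounded_linear_submod.
HB.instance Definition _ := [SubChoice_isSubLmodule of bounded_operator by <:].

Implicit Types S T : bounded_operator.

Lemma boL T : linear T.
Proof. by have /asboolP[] := bounded_operatorP T. Qed.

HB.instance Definition _ T := GRing.isLinear.Build R[i] H H *:%R T (boL T).

Lemma bo_eqP S T : S =1 T -> S = T.
Proof. by move=> ST; apply: val_inj; exact/funext. Qed.

Lemma bo_bounded T : exists2 M : R, 0 <= M & forall x, rnorm (T x) <= M * rnorm x.
Proof.
have /asboolP[_ [M TM]] := bounded_operatorP T.
exists (complex.Re `|M|) => [|x]; first by rewrite -ler0c RRe_real ?normr_real.
rewrite -lecR rmorphM/= -!rnormE ?RRe_real ?normr_real//.
have [x0|x0] := eqVneq `|x| 0.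
  by rewrite (le_trans (TM x))// x0 !mulr0.
rewrite (le_trans (TM x))//; have Mx : M * `|x| \is Num.real.
  exact: ger0_real (le_trans (normr_ge0 _) (TM x)).
have := real_ler_norm Mx; by rewrite normrM normr_id.
Qed.

Definition opnorm T : R[i] :=
  (sup [set complex.Re `|T x| | x in [set x : H | `|x| <= 1]])%:C.

Let opnorm_sup T : has_sup [set complex.Re `|T x| | x in [set x : H | `|x| <= 1]].
Proof.
split; first by exists (complex.Re `|T 0|), 0 => //=; rewrite normr0.
have [M M0 TM] := bo_bounded T; exists M => _ [x /= x1 <-].
apply: (le_trans (TM x)); rewrite ler_piMr//.
by rewrite -lecR -rnormE.
Qed.

Lemma opnorm_ge0 T : 0 <= opnorm T.
Proof.
rewrite ler0c; apply: le_trans (rnorm_ge0 (T 0)) _.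
by apply: ub_le_sup; [case: (opnorm_sup T)|exists 0 => //=; rewrite normr0].
Qed.

Lemma ler_opnorm T x : `|T x| <= opnorm T * `|x|.
Proof.
have [->|x0] := eqVneq x 0; first by rewrite linear0 !normr0 mulr0.
have nx : 0 < `|x| by rewrite normr_gt0.
rewrite -ler_pdivrMr// mulrC -[X in X * _](ger0_norm (ltW _)) ?invr_gt0//.
rewrite -normrZ -linearZ/= [X in X <= _]rnormE lecR.
apply: ub_le_sup; first by case: (opnorm_sup T).
exists (`|x|^-1 *: x) => //=.
by rewrite normrZ ger0_norm ?invr_ge0// mulVf// gt_eqF.
Qed.

Lemma opnorm_le T (M : R[i]) : 0 <= M ->
  (forall x, `|T x| <= M * `|x|) -> opnorm T <= M.
Proof.
move=> M0 TM; have /complex_realP[m mE] : M \is Num.real by rewrite ger0_real.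
rewrite mE lecR; apply: ge_sup; first by case: (opnorm_sup T).
move=> _ [x /= x1 <-]; rewrite -lecR -mE RRe_real ?normr_real//.
by rewrite (le_trans (TM x))// ler_piMr.
Qed.

Lemma opnormD S T : opnorm (S + T) <= opnorm S + opnorm T.
Proof.
apply: opnorm_le => [|x]; first by rewrite addr_ge0 ?opnorm_ge0.
by rewrite (le_trans (ler_normD _ _))// mulrDl lerD ?ler_opnorm.
Qed.

Lemma opnormZ_le c T : opnorm (c *: T) <= `|c| * opnorm T.
Proof.
apply: opnorm_le => [|x]; first by rewrite mulr_ge0 ?opnorm_ge0.
by rewrite normrZ -mulrA ler_wpM2l ?ler_opnorm.
Qed.

Lemma opnormZ c T : opnorm (c *: T) = `|c| * opnorm T.
Proof.
apply/le_anti; rewrite opnormZ_le/=.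
have [->|c0] := eqVneq c 0; first by rewrite normr0 mul0r opnorm_ge0.
rewrite -ler_pdivlMl ?normr_gt0// -normfV.
by rewrite -[X in opnorm X <= _](scalerK c0) opnormZ_le.
Qed.

Lemma opnorm_eq0 T : opnorm T = 0 -> T = 0.
Proof.
move=> T0; apply: bo_eqP => x; apply/eqP; rewrite -normr_le0.
by rewrite (le_trans (ler_opnorm T x))// T0 mul0r.
Qed.

HB.instance Definition _ := Lmodule_isNormed.Build R[i] bounded_operator
  opnormD opnormZ opnorm_eq0.

Lemma bo_normE T : `|T| = opnorm T. Proof. by []. Qed.

Lemma bo_cauchy_cvg (F : set_system bounded_operator) :
  ProperFilter F -> cauchy F -> cvg F.
Proof.
move=> FF Fc.
have Fe (e : R) : 0 < e -> exists T,
    F [set S : bounded_operator | forall x, `|T x - S x| <= e%:C * `|x|].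
  move=> e0; have /cauchyP/(_ e%:C) := Fc; rewrite gtr0c => /(_ e0)[T TF].
  exists T; apply: filterS TF => S; rewrite -ball_normE/= => /ltW TS x.
  rewrite -[T x - S x]/((T - S) x) (le_trans (ler_opnorm _ _))//.
  by rewrite ler_wpM2r// -bo_normE.
have pc x : cvg ((fun T : bounded_operator => T x) @ F).
  apply: cauchy_cvg; apply/cauchyP => e e0.
  have [e' ee'] : exists e', e = e'%:C by apply/complex_realP; rewrite gtr0_real.
  move: e0; rewrite ee' gtr0c => e0.
  have n0 : 0 < rnorm x + 1 by rewrite ltr_wpDl ?rnorm_ge0.
  have [T TF] := Fe (e' / (rnorm x + 1)) (divr_gt0 e0 n0).
  exists (T x); change (F [set S : bounded_operator | ball (T x) e'%:C (S x)]).
  apply: filterS TF => S /(_ x) TS /=.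
  rewrite -ball_normE/=; apply: (le_lt_trans TS).
  rewrite rnormE -rmorphM ltcR mulrAC -mulrA gtr_pMr// ltr_pdivrMr//.
  by rewrite mul1r ltrDl.
pose L x := lim ((fun T : bounded_operator => T x) @ F).
have Lx x : (fun T : bounded_operator => T x) @ F --> L x by exact: pc.
have Llin : linear L.
  move=> c x y; apply: cvg_lim => //.
  have -> : (fun T : bounded_operator => T (c *: x + y)) =
            (fun T : bounded_operator => c *: T x + T y).
    by apply/funext => T; rewrite linearP.
  by apply: cvgD; [exact: cvgZr|].
have LT (e : R) T : F [set S : bounded_operator | forall x, `|T x - S x| <= e%:C * `|x|] ->
    0 < e -> forall x, `|T x - L x| <= e%:C * `|x|.
  move=> TF e0 x; apply: le_complexP.
    by rewrite mulr_ge0// ltW// gtr0c.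
  move=> d d0; have h : F [set S : bounded_operator | `|L x - S x| <= d%:C].
    by apply: ((@cvgrPdist_le _ _ _ F _ _ _).1 (Lx x)); rewrite gtr0c.
  have [S [/(_ x) TS LS]] := filter_ex (filterI TF h).
  rewrite -[T x - L x](subrKA (S x)) (le_trans (ler_normD _ _))// lerD//.
  by rewrite distrC.
have Lb : L \in bounded_linear.
  apply/asboolP; split=> //; have [T TF] := Fe 1 ltr01.
  exists (opnorm T + 1) => x; have := LT _ _ TF ltr01 x.
  rewrite distrC -[X in _ -> `|X| <= _](subrK (T x)) => h.
  by rewrite (le_trans (ler_normD _ _))// addrC mulrDl lerD ?ler_opnorm.
apply: (@cvgP _ _ (BoundedOperator Lb)).
apply/((@cvgrPdist_le _ _ _ F _ idfun _).2) => e e0.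
have [e' ee'] : exists e', e = e'%:C by apply/complex_realP; rewrite gtr0_real.
move: e0; rewrite ee' gtr0c => e0.
have e20 : 0 < e' / 2 by rewrite divr_gt0.
have [T TF] := Fe (e' / 2) e20.
have := LT _ _ TF e20 => TL.
apply: filterS TF => S TS /=; rewrite bo_normE; apply: opnorm_le.
  by rewrite ltW// gtr0c.
move=> x; rewrite -[(_ - S) x]/(L x - S x) -[L x - S x](subrKA (T x)).
rewrite (le_trans (ler_normD _ _))// [X in X%:C](splitr e') rmorphD/= mulrDl lerD//.
by rewrite distrC.
Qed.

HB.instance Definition _ := Uniform_isComplete.Build bounded_operator bo_cauchy_cvg.

Lemma bo_comp_subproof S T : S \o T \in bounded_linear.
Proof.
apply/asboolP; split=> [c x y|]; first by rewrite /= !linearP.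
exists (opnorm S * opnorm T) => x /=; rewrite (le_trans (ler_opnorm _ _))//.
by rewrite -mulrA ler_wpM2l ?opnorm_ge0 ?ler_opnorm.
Qed.

Definition bo_comp S T := BoundedOperator (bo_comp_subproof S T).

Lemma bo_adjoint_subproof T :
  {S : bounded_operator | forall x y, inner (T x) y = inner x (S y)}.
Proof.
apply: cid; have h y : exists z, forall x, inner (T x) y = inner x z.
  apply: (@riesz _ _ (fun x => inner (T x) y) (opnorm T * `|y|)).
    by move=> c u v; rewrite linearP innerDl innerZl.
  move=> x; rewrite (le_trans (cauchy_schwarz _ _))// mulrAC.
  by rewrite ler_wpM2r// ler_opnorm.
pose S y := sval (cid (h y)).
have SE x y : inner (T x) y = inner x (S y) by rewrite /S; case: cid.
have Sb : S \in bounded_linear.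
  apply/asboolP; split=> [c x y|].
    apply: inner_inj => z; rewrite innerDr innerZr -!SE innerDr innerZr//.
  exists (opnorm T) => y; have [->|y0] := eqVneq (S y) 0.
    by rewrite normr0 mulr_ge0 ?opnorm_ge0.
  rewrite -(@ler_pM2r _ `|S y|) ?normr_gt0// -expr2 sqr_normE -SE.
  rewrite -[X in X <= _]ger0_norm; last by rewrite SE inner_ge0.
  rewrite (le_trans (cauchy_schwarz _ _))// mulrAC ler_wpM2r//.
  exact: ler_opnorm.
by exists (BoundedOperator Sb).
Qed.

Definition bo_adjoint T := sval (bo_adjoint_subproof T).

Lemma bo_adjointE T x y : inner (T x) y = inner x (bo_adjoint T y).
Proof. by rewrite /bo_adjoint; case: bo_adjoint_subproof. Qed.

Lemma bo_adjointP S T :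
  (forall x y, inner (T x) y = inner x (S y)) -> bo_adjoint T = S.
Proof.
by move=> TS; apply: bo_eqP => y; apply: inner_inj => x; rewrite -TS bo_adjointE.
Qed.

Lemma bo_compA : associative bo_comp.
Proof. by move=> S T U; exact: bo_eqP. Qed.

Lemma bo_compDl : left_distributive bo_comp +%R.
Proof. by move=> S T U; exact: bo_eqP. Qed.

Lemma bo_compDr : right_distributive bo_comp +%R.
Proof. by move=> S T U; apply: bo_eqP => x /=; rewrite linearD. Qed.

Lemma bo_compZl c S T : bo_comp (c *: S) T = c *: bo_comp S T.
Proof. exact: bo_eqP. Qed.

Lemma bo_compZr c S T : bo_comp S (c *: T) = c *: bo_comp S T.
Proof. by apply: bo_eqP => x /=; rewrite linearZ. Qed.

Lemma bo_adjointEr T x y : inner x (T y) = inner (bo_adjoint T x) y.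
Proof. by rewrite innerC bo_adjointE -innerC. Qed.

Lemma bo_adjointK : involutive bo_adjoint.
Proof. by move=> T; apply: bo_adjointP => x y; rewrite bo_adjointEr. Qed.

Lemma bo_adjointD : {morph bo_adjoint : S T / S + T}.
Proof.
move=> S T; apply: bo_adjointP => x y.
by rewrite innerDl innerDr !bo_adjointE.
Qed.

Lemma bo_adjointZ c T : bo_adjoint (c *: T) = c^* *: bo_adjoint T.
Proof.
by apply: bo_adjointP => x y; rewrite innerZl innerZr conjCK bo_adjointE.
Qed.

Lemma bo_adjointM S T :
  bo_adjoint (bo_comp S T) = bo_comp (bo_adjoint T) (bo_adjoint S).
Proof. by apply: bo_adjointP => x y /=; rewrite !bo_adjointE. Qed.

Lemma bo_norm_comp S T : `|bo_comp S T| <= `|S| * `|T|.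
Proof.
rewrite !bo_normE; apply: opnorm_le => [|x].
  by rewrite mulr_ge0 ?opnorm_ge0.
rewrite /= (le_trans (ler_opnorm _ _))//.
by rewrite -mulrA ler_wpM2l ?opnorm_ge0 ?ler_opnorm.
Qed.

Lemma bo_norm_adjoint_le T : `|T| ^+ 2 <= `|bo_comp (bo_adjoint T) T|.
Proof.
set U := bo_comp _ _; have U0 : 0 <= `|U| by [].
rewrite -[X in _ <= X]sqrtCK ler_pXn2r ?nnegrE ?sqrtC_ge0//.
rewrite [X in X <= _]bo_normE; apply: opnorm_le; first by rewrite sqrtC_ge0.
move=> x; rewrite -(@ler_pXn2r _ 2) ?nnegrE ?mulr_ge0 ?sqrtC_ge0//.
rewrite exprMn sqrtCK sqr_normE bo_adjointE.
rewrite -[X in X <= _]ger0_norm; last by rewrite -bo_adjointE inner_ge0.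
rewrite (le_trans (cauchy_schwarz _ _))// expr2 mulrCA ler_wpM2l//.
exact: (ler_opnorm U).
Qed.

Lemma bo_norm_adjoint T : `|bo_adjoint T| = `|T|.
Proof.
suff le (S : bounded_operator) : `|S| <= `|bo_adjoint S|.
  by apply/le_anti; rewrite le -[X in _ <= `|X|]bo_adjointK le.
have [->|S0] := eqVneq S 0; first by rewrite normr0.
rewrite -(@ler_pM2r _ `|S|) ?normr_gt0// -expr2.
by rewrite (le_trans (bo_norm_adjoint_le S))// bo_norm_comp.
Qed.

Lemma bo_cstar_identity T : `|bo_comp (bo_adjoint T) T| = `|T| ^+ 2.
Proof.
apply/le_anti; rewrite bo_norm_adjoint_le andbT (le_trans (bo_norm_comp _ _))//.
by rewrite bo_norm_adjoint expr2.
Qed.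

HB.instance Definition _ := isCStarAlgebra.Build R bounded_operator
  bo_compA bo_compDl bo_compDr bo_compZl bo_compZr
  bo_adjointK bo_adjointD bo_adjointZ bo_adjointM
  bo_norm_comp bo_cstar_identity.

End BoundedOperators.

Definition infinite_dimensional (R : realType) (H : lmodType R[i]) : Prop :=
  ~ exists (n : nat) (e : 'I_n -> H),
      forall x : H, exists c : 'I_n -> R[i], x = \sum_(i < n) c i *: e i.

(* *-isomorphism; it is automatically isometric. *)
Definition cstar_isomorphic (R : realType) (A B : cstarAlgebraType R) : Prop :=
  exists phi : {linear A -> B},
    [/\ bijective phi,
        forall a b : A, phi (cmul a b) = cmul (phi a) (phi b) &
        forall a : A, phi (cstar a) = cstar (phi a)].

Section Homeomorphisms.
Variables (X Y : topologicalType).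

Definition homeo_on (A : set X) (B : set Y) (f : X -> Y) : Prop :=
  [/\ {within A, continuous f}, f @` A = B &
      exists g : Y -> X,
        {within B, continuous g} /\ forall x, A x -> g (f x) = x].

(* [f] is a local homeomorphism from the whole of [X] to the subspace [B]. *)
Definition local_homeo (B : set Y) (f : X -> Y) : Prop :=
  forall x : X, exists U : set X,
    [/\ open U, U x, exists2 W, open W & f @` U = B `&` W &
        homeo_on U (f @` U) f].

End Homeomorphisms.

(* A groupoid is given by its set of arrows, units being particular arrows.
   The product is a total function whose value [gmul x y] is meaningful only
   when [gsrc x = grng y]. *)
HB.mixin Record isGroupoid G := {
  gsrc : G -> G;
  grng : G -> G;
  gmul : G -> G -> G;
  ginv : G -> G;
  gsrc_src : forall x, gsrc (gsrc x) = gsrc x;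
  grng_src : forall x, grng (gsrc x) = gsrc x;
  gsrc_rng : forall x, gsrc (grng x) = grng x;
  grng_rng : forall x, grng (grng x) = grng x;
  gsrc_mul : forall x y, gsrc x = grng y -> gsrc (gmul x y) = gsrc y;
  grng_mul : forall x y, gsrc x = grng y -> grng (gmul x y) = grng x;
  gmulA : forall x y z, gsrc x = grng y -> gsrc y = grng z ->
    gmul x (gmul y z) = gmul (gmul x y) z;
  gmul_rng : forall x, gmul (grng x) x = x;
  gmul_src : forall x, gmul x (gsrc x) = x;
  gsrc_inv : forall x, gsrc (ginv x) = grng x;
  grng_inv : forall x, grng (ginv x) = gsrc x;
  gmul_invr : forall x, gmul x (ginv x) = grng x;
  gmul_invl : forall x, gmul (ginv x) x = gsrc x
}.
#[short(type="groupoidType")]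
HB.structure Definition Groupoid := {G of isGroupoid G}.

HB.mixin Record isTopologicalGroupoid G & Topological G & Groupoid G := {
  ginv_continuous : continuous (ginv : G -> G);
  gmul_continuous : {within [set p : G * G | gsrc p.1 = grng p.2],
                      continuous (fun p : G * G => gmul p.1 p.2)}
}.
#[short(type="topGroupoidType")]
HB.structure Definition TopologicalGroupoid :=
  {G of Topological G & Groupoid G & isTopologicalGroupoid G}.

Definition gunits {G : groupoidType} : set G := [set u | gsrc u = u].

HB.mixin Record isEtaleGroupoid G & TopologicalGroupoid G := {
  etale_locally_compact : locally_compact [set: G];
  etale_hausdorff : hausdorff_space G;
  gsrc_local_homeo : local_homeo gunits (gsrc : G -> G);
  grng_local_homeo : local_homeo gunits (grng : G -> G)
}.
#[short(type="etaleGroupoidType")]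
HB.structure Definition EtaleGroupoid :=
  {G of TopologicalGroupoid G & isEtaleGroupoid G}.

Definition circle {R : realType} : set R[i] := [set z | `|z| = 1].

(* The extension G^(0) x T --iota--> twist_total --q--> G.  The function [iota]
   is only constrained on [gunits `*` circle]; the unit [u] of G is
   identified with the unit [iota u 1] of the total groupoid. *)
Record twist (R : realType) (G : etaleGroupoidType) := Twist {
  twist_total :> topGroupoidType;
  twist_iota : G -> R[i] -> twist_total;
  twist_q : twist_total -> G;
  twist_locally_compact : locally_compact [set: twist_total];
  twist_hausdorff : hausdorff_space twist_total;
  twist_iota_homeo : homeo_on (gunits `*` circle) (twist_q @^-1` gunits)
    (fun p : G * R[i] => twist_iota p.1 p.2);
  twist_iota_src : forall u z, gunits u -> circle z ->
    gsrc (twist_iota u z) = twist_iota u 1;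
  twist_iota_rng : forall u z, gunits u -> circle z ->
    grng (twist_iota u z) = twist_iota u 1;
  twist_iota_mul : forall u z w, gunits u -> circle z -> circle w ->
    gmul (twist_iota u z) (twist_iota u w) = twist_iota u (z * w);
  twist_q_iota : forall u z, gunits u -> circle z ->
    twist_q (twist_iota u z) = u;
  twist_q_continuous : continuous twist_q;
  twist_q_open : forall U : set twist_total, open U -> open (twist_q @` U);
  twist_q_surj : forall g : G, exists x, twist_q x = g;
  twist_q_src : forall x, twist_q (gsrc x) = gsrc (twist_q x);
  twist_q_rng : forall x, twist_q (grng x) = grng (twist_q x);
  twist_q_mul : forall x y, gsrc x = grng y ->
    twist_q (gmul x y) = gmul (twist_q x) (twist_q y);
  twist_central : forall x z, circle z ->
    gmul (twist_iota (grng (twist_q x)) z) x =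
    gmul x (twist_iota (gsrc (twist_q x)) z);
  twist_locally_trivial : forall g : G, exists U : set G,
    [/\ open U, U g & exists phi : G * R[i] -> twist_total,
      [/\ homeo_on (U `*` circle) (twist_q @^-1` U) phi,
          forall h z, U h -> circle z -> twist_q (phi (h, z)) = h &
          forall h z w, U h -> circle z -> circle w ->
            phi (h, w * z) =
            gmul (twist_iota (grng h) w) (phi (h, z))]]
}.

Section ReducedAlgebra.
Variables (R : realType) (G : etaleGroupoidType) (E : twist R G).
Local Notation q := (@twist_q R G E).
Implicit Types (f h : E -> R[i]) (u : G) (x : E).

Definition twist_act (z : R[i]) x : E := gmul (twist_iota E (grng (q x)) z) x.

Definition equivariant f : Prop :=
  forall z x, circle z -> f (twist_act z x) = z * f x.

Definition Cc : set (E -> R[i]) :=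
  [set f | [/\ continuous f, compact (closure [set x | f x != 0]) &
               equivariant f]].

(* One representative in the twist for each element of G; on products of
   equivariant functions the sums below do not depend on this choice. *)
Definition twist_rep (g : G) : E := sval (cid (twist_q_surj E g)).

(* For [f] in [Cc] only finitely many terms of the sum are nonzero. *)
Definition convolution f h : E -> R[i] := fun x =>
  \sum_(g \in [set g : G | grng g = grng (q x)])
    f (twist_rep g) * h (gmul (ginv (twist_rep g)) x).

Definition involution f : E -> R[i] := fun x => (f (ginv x))^*.

Definition l2_norm u h : \bar R :=
  sqrte (\esum_(g in [set g : G | gsrc g = u])
           ((complex.Re `|h (twist_rep g)|) ^+ 2)%:E).

(* l^2(G_u, E_u); functions on the preimage of G_u are extended by 0. *)
Definition l2_space u : set (E -> R[i]) :=
  [set h | [/\ equivariant h, forall x, gsrc (q x) <> u -> h x = 0 &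
               (l2_norm u h < +oo)%E]].

Definition regular_rep (u : G) f h : E -> R[i] := convolution f h.

Definition regular_rep_norm u f : \bar R :=
  ereal_sup [set l2_norm u (regular_rep u f h) |
              h in [set h | l2_space u h /\ (l2_norm u h <= 1)%E]].

(* The supremum is taken in [0, +oo]: it is 0 when G is empty. *)
Definition reduced_norm f : \bar R :=
  ereal_sup ([set 0%E] `|` [set regular_rep_norm u f | u in @gunits G]).

(* A completion of the *-algebra [Cc] in the norm [reduced_norm]: a C*-algebra
   with an isometric *-homomorphism from [Cc] with dense range, hence unique
   up to isomorphism.  [completion_map] is unconstrained outside [Cc]. *)
Record reduced_cstar_algebra := ReducedCStarAlgebra {
  completion_sort :> cstarAlgebraType R;
  completion_map : (E -> R[i]) -> completion_sort;
  completion_map_linear : forall (c : R[i]) f h, Cc f -> Cc h ->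
    completion_map (fun x => c * f x + h x) =
    c *: completion_map f + completion_map h;
  completion_map_mul : forall f h, Cc f -> Cc h ->
    completion_map (convolution f h) =
    cmul (completion_map f) (completion_map h);
  completion_map_star : forall f, Cc f ->
    completion_map (involution f) = cstar (completion_map f);
  completion_map_isometry : forall f, Cc f ->
    (complex.Re `|completion_map f|)%:E = reduced_norm f;
  completion_map_dense : dense (completion_map @` Cc)
}.

End ReducedAlgebra.

(* Main.v *)
Require Import Defs.
From mathcomp Require Import all_boot all_order all_algebra complex.
From mathcomp Require Import ring lra.
From mathcomp Require Import all_classical all_reals all_analysis.

(* Let phi be an isomorphism of B(H) onto C*_r(G, E), and let ev be the continuous
   extension to C*_r(G, E) of the evaluation of functions on E.

   A rank one operator e on xi has ev e x <> 0 for some x, so |ev e| stays above a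
   constant c > 0 on an open set, whose sources form an open set W of units.  Any
   bump function d on W with d u = 1 at some u in W acts on H with |d xi| >= c / |xi|.
   As orthogonal contributions add up, W cannot be split into arbitrarily many open
   pieces, so it has isolated points; hence the projections p_u attached to the
   isolated units u are pairwise orthogonal with sum 1.

   The evaluation at u is a faithful trace on the corner p_u C*_r(G, E) p_u, which is
   B(p_u H); hence p_u H is finite-dimensional, and there are infinitely many isolated
   units.  Pick unit vectors in infinitely many different p_u H and a partial isometry
   T whose n-th column is flat, with n + 1 coefficients (n + 1)^(-1/2).  An element of
   C_c(G, E) has, for some N, at most N nonzero entries in each column, so it stays
   at a distance from T bounded below as n grows. *)

Set Implicit Arguments.
Unset Strict Implicit.
Unset Printing Implicit Defensive.

Import Order.TTheory GRing.Theory Num.Theory numFieldNormedType.Exports.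

Local Open Scope classical_set_scope.
Local Open Scope complex_scope.
Local Open Scope ring_scope.


(** An element of [A] is not a function, and the norm of [A] is prescribed only on the image of
    [Cc]. Statements about elements of [A] are therefore reached through approximants, and [ev] is
    built to be 1-Lipschitz, so that a function close to [a] in norm is pointwise close to [ev a].
    The isomorphism is given as a bijective linear *-homomorphism. Norms of images are needed only
    for rank one operators and projections, where the C*-identity computes or bounds them. Rank one
    operators turn values of functions into norms of vectors: for [e] on [xi] and a self-adjoint
    [d], the product [e d] has norm [|xi| |d xi|], while its evaluation is a pointwise product. The
    trace bounds a dimension because [m] orthonormal vectors of [p_u H] span the range of a
    projection of trace [m J], with [J] nonzero and independent of the vectors, while evaluation is
    contractive: [m |J| <= 1]. Flat columns resist sparse approximation: deleting [N] of [2 N + 1]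
    equal coefficients leaves more than half of the squared norm. *)

(** * Real-valued norms and the unit circle *)

Section RealNorm.
Variables (R : realType) (V : normedModType R[i]).
Implicit Types (x y : V) (c : R[i]).

(** Norms take values in [R[i]], whose order is partial; the real part moves estimates to [R], where
    [lra] and [nra] apply. *)
Definition rn x : R := complex.Re `|x|.

Lemma rnE x : `|x| = (rn x)%:C.
Proof. by rewrite /rn RRe_real// normr_real. Qed.

Lemma rn_ge0 x : 0 <= rn x.
Proof. by rewrite -ler0c -rnE. Qed.

Lemma rnD x y : rn (x + y) <= rn x + rn y.
Proof. by rewrite -lecR rmorphD/= -!rnE ler_normD. Qed.

Lemma rnN x : rn (- x) = rn x.
Proof. by rewrite /rn normrN. Qed.

Lemma rn_distC x y : rn (x - y) = rn (y - x).
Proof. by rewrite -rnN opprB. Qed.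

Lemma rn_triangle z x y : rn (x - y) <= rn (x - z) + rn (z - y).
Proof. by rewrite -[x - y](subrKA z) rnD. Qed.

Lemma rnZ c x : rn (c *: x) = complex.Re `|c| * rn x.
Proof.
by apply: (@complexI R); rewrite rmorphM -!rnE normrZ; congr (_ * _); exact: rnE.
Qed.

Lemma rn0 : rn 0 = 0. Proof. by rewrite /rn normr0. Qed.

Lemma rn_eq0 x : (rn x == 0) = (x == 0).
Proof. by rewrite -[x == 0]normr_eq0 rnE -(inj_eq (@complexI R)). Qed.

Lemma rn_le_lim x (M : R) : (forall e : R, 0 < e -> rn x <= M + e) -> rn x <= M.
Proof. by move=> h; apply/ler_addgt0Pr. Qed.

End RealNorm.

Section ComplexNorm.
Variable R : realType.
Implicit Types (c d : R[i]) (a : R).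

Lemma rnM c d : rn (c * d) = rn c * rn d.
Proof. exact: (rnZ c (d : R[i]^o)). Qed.

Lemma rn_circle c : circle c -> rn c = 1.
Proof. by rewrite /circle/= /rn => ->. Qed.

Lemma rn_real a : rn (a%:C) = `|a|.
Proof.
have [a0|a0] := leP 0 a; first by rewrite /rn ger0_norm ?ler0c//= ger0_norm.
rewrite -rnN -[in RHS]normrN -rmorphN/= /rn ger0_norm ?ler0c//= ?ger0_norm//.
  by rewrite oppr_ge0 ltW.
by rewrite oppr_ge0 ltW.
Qed.

Lemma rn_conj c : rn (Num.conj c) = rn c.
Proof. by rewrite /rn norm_conjC. Qed.

Lemma rn_nat (n : nat) : rn (n%:R : R[i]) = n%:R.
Proof. by rewrite -(rmorph_nat (real_complex R)) rn_real normr_nat. Qed.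

Lemma mul_conj c : c * Num.conj c = (rn c ^+ 2)%:C.
Proof. by rewrite -normCK rnE rmorphXn. Qed.

Lemma rn_sum (I : Type) (r : seq I) (P : pred I) (F : I -> R[i]) :
  rn (\sum_(i <- r | P i) F i) <= \sum_(i <- r | P i) rn (F i).
Proof.
elim/big_rec2: _ => [|i x y _ h]; first by rewrite rn0.
by rewrite (le_trans (rnD _ _))// lerD2l.
Qed.

Lemma rn_Re c : `|complex.Re c| <= rn c.
Proof. by rewrite -lecR -rnE normc_ge_Re. Qed.

Lemma rn_ReIm c : rn c <= `|complex.Re c| + `|complex.Im c|.
Proof.
rewrite [c in rn c]complexE (le_trans (rnD _ _))// rnM !rn_real.
have -> : rn ('i : R[i]) = 1 by rewrite /rn normCi.
by rewrite mul1r.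
Qed.

Lemma rn_Im c : `|complex.Im c| <= rn c.
Proof.
have -> : complex.Im c = - complex.Re ('i * c) by case: c => a b /=; ring.
by rewrite normrN (le_trans (rn_Re _))// rnM {1}/rn normCi mul1r.
Qed.

Lemma circle1 : circle (1 : R[i]). Proof. exact: normr1. Qed.

Lemma circleM c d : circle c -> circle d -> circle (c * d).
Proof. by rewrite /circle/= normrM => -> ->; rewrite mul1r. Qed.

Lemma circleV c : circle c -> circle c^-1.
Proof. by rewrite /circle/= normfV => ->; rewrite invr1. Qed.

Lemma circle_neq0 c : circle c -> c != 0.
Proof. by rewrite /circle/= -normr_eq0 => ->; rewrite oner_eq0. Qed.

Lemma circle_conj c : circle c -> Num.conj c = c^-1.
Proof. by move=> hc; rewrite [RHS]invC_norm hc expr1n invr1 mul1r. Qed.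

End ComplexNorm.


(** * Algebra of groupoids and twists *)

Section GroupoidTheory.
Variable T : groupoidType.
Implicit Types x y u : T.

Lemma gmulK x y : gsrc x = grng y -> gmul (ginv x) (gmul x y) = y.
Proof. by move=> h; rewrite gmulA ?gsrc_inv// gmul_invl h gmul_rng. Qed.

Lemma gmulVK x y : grng x = grng y -> gmul x (gmul (ginv x) y) = y.
Proof.
by move=> h; rewrite gmulA ?grng_inv ?gsrc_inv// gmul_invr h gmul_rng.
Qed.

Lemma gmulrK x y : gsrc x = grng y -> gmul (gmul x y) (ginv y) = x.
Proof. by move=> h; rewrite -gmulA ?grng_inv// gmul_invr -h gmul_src. Qed.

Lemma gmulrVK x y : gsrc x = gsrc y -> gmul (gmul x (ginv y)) y = x.
Proof.
by move=> h; rewrite -gmulA ?grng_inv ?gsrc_inv// gmul_invl -h gmul_src.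
Qed.

Lemma ginv_unique x y : gsrc x = grng y -> gmul x y = grng x -> y = ginv x.
Proof.
by move=> h xy; rewrite -[LHS](gmulK h) xy -gsrc_inv gmul_src.
Qed.

Lemma ginvK x : ginv (ginv x) = x.
Proof.
by apply/esym/ginv_unique; rewrite ?gsrc_inv// gmul_invl grng_inv.
Qed.

Lemma ginv_mul x y : gsrc x = grng y ->
  ginv (gmul x y) = gmul (ginv y) (ginv x).
Proof.
move=> h; apply/esym/ginv_unique.
  by rewrite gsrc_mul// grng_mul ?gsrc_inv ?grng_inv.
by rewrite gmulA ?gsrc_inv ?grng_inv ?gsrc_mul// gmulrK// gmul_invr grng_mul.
Qed.

Lemma gunits_src x : gunits (gsrc x). Proof. exact: gsrc_src. Qed.

Lemma gunits_rng x : gunits (grng x). Proof. exact: gsrc_rng. Qed.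

Lemma grng_unit u : gunits u -> grng u = u.
Proof. by move=> hu; rewrite -{1}hu grng_src. Qed.

Lemma ginv_unit u : gunits u -> ginv u = u.
Proof.
move=> hu; have ru := grng_unit hu; apply/esym/ginv_unique; first by rewrite ru.
by rewrite -{2}hu gmul_src ru.
Qed.

Lemma gunits_inv x : gunits (ginv x) -> gunits x.
Proof. by move=> hx; rewrite -[x]ginvK ginv_unit. Qed.

Lemma gunits_mulV x y : grng x = grng y -> gunits (gmul (ginv x) y) -> x = y.
Proof.
move=> h hu; rewrite -[y](gmulVK h).
have <- : gsrc x = gmul (ginv x) y by rewrite -(grng_unit hu) grng_mul ?grng_inv
  ?gsrc_inv.
by rewrite gmul_src.
Qed.

End GroupoidTheory.

Section TwistTheory.
Variables (R : realType) (G : etaleGroupoidType) (E : twist R G).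
Local Notation q := (@twist_q R G E).
Local Notation iota := (@twist_iota R G E).
Implicit Types (x y : E) (z w : R[i]) (u g : G).

(** On arrows over units, the second component is the circle coordinate; its continuity is what
    makes [diag d] continuous. *)
Definition iota_inv : E -> G * R[i] :=
  let: And3 _ _ h := twist_iota_homeo E in sval (cid h).

Lemma iota_inv_continuous : {within q @^-1` gunits, continuous iota_inv}.
Proof. by rewrite /iota_inv; case: twist_iota_homeo => _ _ h; case: cid => ? []. Qed.

Lemma iota_invK u z : gunits u -> circle z -> iota_inv (iota u z) = (u, z).
Proof.
move=> hu hz; rewrite /iota_inv; case: twist_iota_homeo => _ _ h.
by case: cid => /= f [_ /(_ (u, z))]; apply.
Qed.

Lemma iota_surj x : gunits (q x) -> exists2 z, circle z & x = iota (q x) z.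
Proof.
move=> hx; have [_ im _] := twist_iota_homeo E.
have : (q @^-1` gunits) x by [].
rewrite -im => -[[u z] /= [hu hz] <-].
by exists z => //; rewrite twist_q_iota.
Qed.

(** [gsrc x] lies over a unit, so it is some [iota u z], whose source is [iota u 1]; but [gsrc x] is
    its own source. Composability in the twist can thus be tested in [G]. *)
Lemma gsrcE x : gsrc x = iota (gsrc (q x)) 1.
Proof.
have h : gunits (q (gsrc x)) by rewrite twist_q_src; exact: gunits_src.
have [z hz e] := iota_surj h.
by rewrite -(gsrc_src x) e twist_iota_src// twist_q_src.
Qed.

Lemma grngE x : grng x = iota (grng (q x)) 1.
Proof.
have h : gunits (q (grng x)) by rewrite twist_q_rng; exact: gunits_rng.
have [z hz e] := iota_surj h.
by rewrite -(grng_rng x) e twist_iota_rng// twist_q_rng.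
Qed.

Lemma composable x y : gsrc (q x) = grng (q y) -> gsrc x = grng y.
Proof. by rewrite gsrcE grngE => ->. Qed.

Lemma q_inv x : q (ginv x) = ginv (q x).
Proof.
apply: ginv_unique; first by rewrite -twist_q_src -twist_q_rng grng_inv.
by rewrite -twist_q_mul ?grng_inv// gmul_invr twist_q_rng.
Qed.

Lemma src_iota_rng z x : circle z -> gsrc (iota (grng (q x)) z) = grng x.
Proof.
by move=> hz; rewrite twist_iota_src//; [rewrite -grngE | exact: gunits_rng].
Qed.

Lemma q_act z x : circle z -> q (twist_act z x) = q x.
Proof.
move=> hz; have hu := gunits_rng (q x).
rewrite /twist_act twist_q_mul; last exact: src_iota_rng.
by rewrite twist_q_iota// gmul_rng.
Qed.

Lemma rng_act z x : circle z -> grng (twist_act z x) = grng x.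
Proof. by move=> hz; rewrite !grngE q_act. Qed.

Lemma src_act z x : circle z -> gsrc (twist_act z x) = gsrc x.
Proof. by move=> hz; rewrite !gsrcE q_act. Qed.

Lemma act1 x : twist_act 1 x = x.
Proof. by rewrite /twist_act -grngE gmul_rng. Qed.

Lemma actA z w x : circle z -> circle w ->
  twist_act z (twist_act w x) = twist_act (z * w) x.
Proof.
move=> hz hw; have hu := gunits_rng (q x).
rewrite {1}/twist_act q_act// /twist_act gmulA ?twist_iota_mul//.
  by rewrite twist_iota_src// twist_iota_rng.
exact: src_iota_rng.
Qed.

Lemma act_mul z x y : circle z -> gsrc x = grng y ->
  gmul (twist_act z x) y = twist_act z (gmul x y).
Proof.
move=> hz h; have hu := gunits_rng (q x).
have h' : gsrc (q x) = grng (q y) by rewrite -twist_q_src -twist_q_rng h.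
by rewrite /twist_act twist_q_mul// grng_mul// gmulA//; exact: src_iota_rng.
Qed.

Lemma mul_act z x y : circle z -> gsrc x = grng y ->
  gmul x (twist_act z y) = twist_act z (gmul x y).
Proof.
move=> hz h; have hu := gunits_rng (q y).
have e : grng (q y) = gsrc (q x) by rewrite -twist_q_src -twist_q_rng h.
rewrite {1}/twist_act gmulA.
- by rewrite e -twist_central// act_mul.
- by rewrite twist_iota_rng// -grngE.
- exact: src_iota_rng.
Qed.

Lemma inv_act z x : circle z -> ginv (twist_act z x) = twist_act z^-1 (ginv x).
Proof.
move=> hz; have hz' := circleV hz; apply/esym/ginv_unique.
  by rewrite src_act// rng_act// grng_inv.
rewrite act_mul// ?rng_act ?grng_inv// mul_act ?grng_inv//.
by rewrite actA// mulfV ?circle_neq0// act1 gmul_invr.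
Qed.

Lemma iota_act u z w : gunits u -> circle z -> circle w ->
  twist_act z (iota u w) = iota u (z * w).
Proof.
by move=> hu hz hw; rewrite /twist_act twist_q_iota// grng_unit// twist_iota_mul.
Qed.

Lemma iota_act1 u z : gunits u -> circle z -> twist_act z (iota u 1) = iota u z.
Proof. by move=> hu hz; rewrite iota_act ?mulr1//; exact: circle1. Qed.

(** The product of [y] with the inverse of [x] lies over a unit, hence is [iota _ z]. *)
Lemma fiber_act x y : q x = q y -> exists2 z, circle z & y = twist_act z x.
Proof.
move=> e; have sxy : gsrc y = gsrc x by rewrite !gsrcE e.
have h : gsrc y = grng (ginv x) by rewrite grng_inv.
have [z hz ez] : exists2 z, circle z & gmul y (ginv x) = iota (grng (q y)) z.
  have qe : q (gmul y (ginv x)) = grng (q y).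
    by rewrite twist_q_mul// q_inv e gmul_invr.
  have := iota_surj (x := gmul y (ginv x)); rewrite qe; apply.
  exact: gunits_rng.
by exists z => //; rewrite /twist_act e -ez gmulrVK.
Qed.

Lemma inv_iota u z : gunits u -> circle z -> ginv (iota u z) = iota u z^-1.
Proof.
move=> hu hz; have hz' := circleV hz; apply/esym/ginv_unique.
  by rewrite twist_iota_src// twist_iota_rng.
by rewrite twist_iota_mul// divff ?circle_neq0// twist_iota_rng.
Qed.

Lemma twist_repK g : q (twist_rep E g) = g.
Proof. by rewrite /twist_rep; case: cid. Qed.

Lemma twist_rep_act x : exists2 z, circle z & twist_rep E (q x) = twist_act z x.
Proof. by apply: fiber_act; rewrite twist_repK. Qed.

Lemma equivariant_rn (f : E -> R[i]) x y : equivariant f -> q x = q y ->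
  rn (f x) = rn (f y).
Proof.
move=> fe /fiber_act[z hz ->].
by rewrite fe// rnM (rn_circle hz) mul1r.
Qed.

Lemma equivariant_neq0 (f : E -> R[i]) x y : equivariant f -> q x = q y ->
  (f x == 0) = (f y == 0).
Proof. by move=> fe /(equivariant_rn fe) e; rewrite -!rn_eq0 e. Qed.

End TwistTheory.


(** * Functions supported over the units and their convolution *)

Section Diagonal.
Variables (R : realType) (G : etaleGroupoidType) (E : twist R G).
Local Notation q := (@twist_q R G E).
Local Notation iota := (@twist_iota R G E).
Implicit Types (x y : E) (z w : R[i]) (u g : G) (d : G -> R[i]) (f h : E -> R[i]).

(** An element of the diagonal subalgebra, written as an equivariant function on the twist. *)
Definition diag d : E -> R[i] := fun x =>
  if `[< gunits (q x) >] then (iota_inv x).2 * d (q x) else 0.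

Lemma diag_iota d u z : gunits u -> circle z -> diag d (iota u z) = z * d u.
Proof.
move=> hu hz; rewrite /diag twist_q_iota//.
by case: asboolP => // _; rewrite iota_invK.
Qed.

Lemma diag_out d x : ~ gunits (q x) -> diag d x = 0.
Proof. by move=> hx; rewrite /diag; case: asboolP. Qed.

Lemma diag_neq0 d x : diag d x != 0 -> gunits (q x) /\ d (q x) != 0.
Proof.
rewrite /diag; case: asboolP => [hx|]; last by rewrite eqxx.
by rewrite mulf_eq0 negb_or => /andP[].
Qed.

Lemma diag_equivariant d : equivariant (diag d).
Proof.
move=> z x hz; have [hx|hx] := pselect (gunits (q x)); last first.
  by rewrite !diag_out ?mulr0// q_act.
have [w hw ->] := iota_surj hx.
rewrite iota_act// !diag_iota//; last exact: circleM.
by rewrite mulrA.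
Qed.

Lemma convolution_single f h x g0 : grng g0 = grng (q x) ->
  (forall g, grng g = grng (q x) -> g <> g0 ->
     f (twist_rep E g) * h (gmul (ginv (twist_rep E g)) x) = 0) ->
  convolution f h x = f (twist_rep E g0) * h (gmul (ginv (twist_rep E g0)) x).
Proof.
move=> hg0 h0; rewrite /convolution -(@fsbig_widen _ _ _ _ [set g0]).
- by rewrite fsbig_set1.
- by move=> _ ->.
- by move=> g [/= hg ng]; exact: h0.
Qed.

(** Only the unit [grng (q x)] contributes to the sum. The phase [w] of its chosen representative
    cancels, because one factor carries [w] and the other carries its inverse. *)
Lemma convolution_diagl d f x : equivariant f ->
  convolution (diag d) f x = d (grng (q x)) * f x.
Proof.
move=> fe; have hu := gunits_rng (q x).
rewrite (@convolution_single _ _ _ (grng (q x))); last 2 first.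
- by rewrite grng_rng.
- move=> g hg ng; rewrite diag_out ?mul0r// twist_repK => gu; apply: ng.
  by rewrite -hg grng_unit.
have gu : gunits (q (twist_rep E (grng (q x)))) by rewrite twist_repK.
have [w hw] := iota_surj gu; rewrite twist_repK => ->.
have hw' := circleV hw; rewrite inv_iota// diag_iota//.
rewrite -[gmul _ x]/(twist_act w^-1 x) fe//.
by rewrite mulrACA mulfV ?circle_neq0// mul1r.
Qed.

Lemma convolution_diagr d f x : equivariant f ->
  convolution f (diag d) x = f x * d (gsrc (q x)).
Proof.
move=> fe; have hu := gunits_src (q x).
rewrite (@convolution_single _ _ _ (q x))//; last first.
  move=> g hg ng; rewrite [X in _ * X]diag_out ?mulr0// twist_q_mul; last first.
    by apply: composable; rewrite q_inv twist_repK gsrc_inv.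
  by rewrite q_inv twist_repK => /(gunits_mulV hg).
have [w hw ->] := twist_rep_act x; have hw' := circleV hw.
rewrite inv_act// act_mul ?gsrc_inv// gmul_invl gsrcE iota_act1//.
by rewrite diag_iota// fe// mulrACA mulfV ?circle_neq0// mul1r.
Qed.

Lemma involution_diag d x :
  involution (diag d) x = diag (fun u => Num.conj (d u)) x.
Proof.
rewrite /involution; have [hx|hx] := pselect (gunits (q x)); last first.
  by rewrite !diag_out ?rmorph0// q_inv => /gunits_inv.
have [w hw ->] := iota_surj hx; have hw' := circleV hw.
by rewrite inv_iota// !diag_iota// rmorphM/= circle_conj// invrK.
Qed.

Lemma involution_equivariant f : equivariant f -> equivariant (involution f).
Proof.
move=> fe z x hz; have hz' := circleV hz.
by rewrite /involution inv_act// fe// rmorphM/= circle_conj// invrK.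
Qed.

Lemma rep_mul_act f z y x : equivariant f -> circle z -> grng y = grng x ->
  f (gmul (ginv y) (twist_act z x)) = z * f (gmul (ginv y) x).
Proof. by move=> fe hz e; rewrite mul_act ?gsrc_inv// fe. Qed.

Lemma grng_rep g x : grng g = grng (q x) -> grng (twist_rep E g) = grng x.
Proof. by move=> e; rewrite !grngE twist_repK e. Qed.

Lemma convolution_equivariant f h : equivariant h -> equivariant (convolution f h).
Proof.
move=> he z x hz; rewrite /convolution mulr_fsumr q_act//.
apply: eq_fsbigr => g; rewrite inE/= => hg.
by rewrite (rep_mul_act he hz); [rewrite mulrCA | exact: grng_rep].
Qed.

End Diagonal.

Arguments diag {R G} E d _.


(** * Compactness, local homeomorphisms and bump functions *)

Section Topology.

Lemma continuous_near (T U : topologicalType) (f g : T -> U) (x : T) :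
  (\forall y \near x, f y = g y) -> {for x, continuous g} -> {for x, continuous f}.
Proof.
move=> fg gx; have e : f x = g x by exact: nbhs_singleton fg.
rewrite /prop_for /continuous_at e; apply: cvg_trans gx; apply: near_eq_cvg.
by apply: filterS fg => y ->.
Qed.

Lemma continuous_within_open (T U : topologicalType) (A : set T) (f : T -> U) x :
  open A -> A x -> {within A, continuous f} -> {for x, continuous f}.
Proof.
by move=> oA Ax; rewrite continuous_open_subspace// => /(_ x); apply; rewrite inE.
Qed.

(** If [P K] failed, the sets [A] with [P] true of [K] minus [A] would form a proper filter; at a
    cluster point of it in [K], the local hypothesis gives a contradiction. *)
Lemma compact_ind (T : topologicalType) (P : set T -> Prop) (K : set T) :
  compact K -> P set0 ->
  (forall A B : set T, A `<=` B -> P B -> P A) ->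
  (forall A B : set T, P A -> P B -> P (A `|` B)) ->
  (forall x, K x -> exists2 U, nbhs x U & P U) -> P K.
Proof.
move=> cK P0 PS PU PK; apply: contrapT => nPK.
pose F : set_system T := [set A | P (K `\` A)].
have FF : ProperFilter F.
  apply: Build_ProperFilter_ex.
    move=> A FA; apply: contrapT => /forallNP nA; apply: nPK.
    by apply: PS FA => x Kx; split=> // /nA.
  split; rewrite /F/=.
  - by rewrite setDT.
  - by move=> A B PA PB /=; rewrite setDIr; exact: PU.
  - by move=> A B AB; apply: PS => x [Kx nB]; split=> // /AB.
have [|x [Kx clx]] := cK F FF; first by rewrite /F/= setDv.
have [U xU PrU] := PK x Kx.
have : F (~` U) by apply: PS PrU => y [_ /contrapT].
by move=> /clx/(_ xU)[y []].
Qed.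

End Topology.

Section Circle.
Variable R : realType.

Lemma real_complex_continuous : continuous (real_complex R : R -> R[i]).
Proof.
move=> a; apply/cvgrPdist_le => e e0.
have [e' ee'] : exists e', e = e'%:C by apply/complex_realP; rewrite gtr0_real.
move: e0; rewrite ee' gtr0c => e0.
apply: filterS (nbhsx_ballx a e' e0) => b /ltW; rewrite /ball_/= => ab.
by rewrite -rmorphB/= rnE rn_real lecR.
Qed.

Lemma conjC_continuous : continuous (Num.conj : R[i] -> R[i]).
Proof.
move=> a; apply: (@cvgrPdist_le _ _ _ _ (nbhs_filter a) _ _).2 => e e0.
apply: filterS (nbhsx_ballx a e e0) => b /ltW; rewrite /ball_/= => ab.
by rewrite -rmorphB norm_conjC.
Qed.

Lemma circle_compact : compact (@circle R).
Proof.
pose f (p : R * R) : R[i] := p.1%:C + 'i * p.2%:C.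
have fc : continuous f.
  move=> p; apply: cvgD.
    by apply: continuous_comp; [exact: cvg_fst|exact: real_complex_continuous].
  apply: cvgM; first exact: cvg_cst.
  by apply: continuous_comp; [exact: cvg_snd|exact: real_complex_continuous].
have cI : compact [set` `[(-1)%R, 1%R : R]] by exact: segment_compact.
apply: (@subclosed_compact _ _ (f @` ([set` `[(-1)%R, 1%R]] `*` [set` `[(-1)%R,
  1%R]]))).
- rewrite (_ : circle = (fun z : R[i] => `|z|) @^-1` [set 1])//.
  apply: closed_comp; first by move=> ? _; exact: norm_continuous.
  apply: accessible_closed_set1; apply: hausdorff_accessible.
  exact: norm_hausdorff.
- apply: continuous_compact; last exact: compact_setX.
  exact: continuous_subspaceT.
- move=> z hz; exists (complex.Re z, complex.Im z); last first.
    by rewrite /f/= -complexE.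
  split=> /=; rewrite in_itv/= -ler_norml -(rn_circle hz); [exact: rn_Re|exact: rn_Im].
Qed.

End Circle.

Section LocalHomeomorphism.
Variables (X Y : topologicalType) (B : set Y) (f : X -> Y).
Hypothesis lf : local_homeo B f.

Lemma local_homeo_continuous : continuous f.
Proof.
move=> x; have [U [oU Ux _ [cU _ _]]] := lf x.
exact: continuous_within_open oU Ux cU.
Qed.

Lemma local_homeo_injective x : exists U : set X,
  [/\ open U, U x & forall y z, U y -> U z -> f y = f z -> y = z].
Proof.
have [U [oU Ux _ [_ _ [g [_ gK]]]]] := lf x.
by exists U; split=> // y z Uy Uz e; rewrite -(gK y)// -(gK z)// e.
Qed.

Lemma local_homeo_open (O : set X) : open B -> open O -> open (f @` O).
Proof.
move=> oB oO; rewrite openE => _ [x Ox <-].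
have [U [oU Ux [W oW fU] [_ _ [g [gc gK]]]]] := lf x.
have ofU : open (f @` U) by rewrite fU; exact: openI.
move: gc; rewrite continuous_open_subspace// => gc.
have /(continuous_inP _ ofU) := gc => /(_ (O `&` U) (openI oO oU)) oV.
have : nbhs (f x) (f @` U `&` g @^-1` (O `&` U)).
  by apply: open_nbhs_nbhs; split=> //; split; [exists x|rewrite /= gK].
by apply: filterS => y [[z Uz <-]]; rewrite /= gK// => -[Oz _]; exists z.
Qed.

End LocalHomeomorphism.

Section EtaleTopology.
Variable G : etaleGroupoidType.
Implicit Types (x u : G).

Lemma gsrc_continuous : continuous (gsrc : G -> G).
Proof. exact: local_homeo_continuous (@gsrc_local_homeo G). Qed.

Lemma grng_continuous : continuous (grng : G -> G).
Proof. exact: local_homeo_continuous (@grng_local_homeo G). Qed.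

(** Near a unit, [x] and [gsrc x] both lie in a set where the source map is injective, and they have
    the same source. *)
Lemma gunits_open : open (gunits : set G).
Proof.
rewrite openE => u hu;
  have [U [oU Uu inj]] := local_homeo_injective (@gsrc_local_homeo G) u.
have : nbhs u (U `&` gsrc @^-1` U).
  apply: open_nbhs_nbhs; split; last by split=> //=; rewrite hu.
  by apply: openI => //; apply: open_comp => // ? _; exact: gsrc_continuous.
by apply: filterS => x [Ux Usx]; apply: inj => //; exact: gsrc_src.
Qed.

(** A limit of units cannot be separated from its own source. *)
Lemma gunits_closed : closed (gunits : set G).
Proof.
move=> x clx; apply: (@etale_hausdorff G) => A B nA nB.
have nA' : nbhs x (gsrc @^-1` A) by exact: gsrc_continuous.
by have [y [e [/= + By]]] := clx _ (filterI nA' nB); rewrite e => Ay; exists y.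
Qed.

Lemma bump_function (R : realType) (V : set G) u : open V -> V u ->
  exists d : G -> R, [/\ continuous d, forall g, 0 <= d g <= 1, d u = 1 &
    exists K, [/\ compact K, K `<=` V & forall g, d g != 0 -> K g]].
Proof.
move=> oV Vu; have lc := @etale_locally_compact G; have hd := @etale_hausdorff G.
have cr := @locally_compact_completely_regular _ R lc hd.
have [C] := lc u I; rewrite withinET => uC [cC _].
have [N uN clN] := @completely_regular_regular R _ cr _ _ (filterI uC (open_nbhs_nbhs
  (conj oV Vu))).
have sep : uniform_separator [set u] (~` N^°).
  by apply: cr; [exact/open_closedC/open_interior|rewrite /= => /(_ uN)].
have [f [fc f01 f0 f1]] := (@uniform_separatorP _ R _ _).1 sep.
exists (fun g => 1 - f g); split.
- by move=> g; apply: cvgB; [exact: cvg_cst|exact: fc].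
- move=> g; have : range f (f g) by exists g.
  by move/f01; rewrite /= in_itv/=; lra.
- by rewrite (f0 (f u)) ?subr0//; exists u.
exists (closure N); split.
- by apply: subclosed_compact cC _; [exact: closed_closure|move=> g /clN[]].
- by move=> g /clN[].
- move=> g fg; apply: subset_closure; apply: contrapT => nN.
  move: fg; rewrite (f1 (f g)) ?subrr ?eqxx//; exists g => //= /interior_subset.
  exact: nN.
Qed.

End EtaleTopology.

(** * Equivariant functions with compact support *)

Section CcTheory.
Variables (R : realType) (G : etaleGroupoidType) (E : twist R G).
Local Notation q := (@twist_q R G E).
Local Notation iota := (@twist_iota R G E).
Implicit Types (x y : E) (z w : R[i]) (u g : G) (d : G -> R[i]) (f h : E -> R[i]).

Lemma compact_support_sub (f : E -> R[i]) (K : set E) : compact K ->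
  (forall x, f x != 0 -> K x) -> compact (closure [set x | f x != 0]).
Proof.
move=> cK fK; have clK : closed K by apply: compact_closed cK; exact: twist_hausdorff.
apply: subclosed_compact cK _; first exact: closed_closure.
by rewrite [X in _ `<=` X](closure_id K).1//; exact: closureS.
Qed.

Lemma open_q_units : open (q @^-1` gunits).
Proof. by apply: open_comp; [move=> ? _;
  exact: twist_q_continuous|exact: gunits_open]. Qed.

Lemma diag_continuous d : continuous d -> continuous (diag E d).
Proof.
move=> dc x; have [hx|hx] := pselect (gunits (q x)).
  apply: (@continuous_near _ _ _ (fun y => (iota_inv y).2 * d (q y))).
    have : nbhs x (q @^-1` gunits) by exact: open_nbhs_nbhs (conj open_q_units hx).
    by apply: filterS => y hy; rewrite /diag; case: asboolP.
  apply: cvgM.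
    apply: continuous_comp; last exact: cvg_snd.
    exact: continuous_within_open open_q_units hx (@iota_inv_continuous R G E).
  by apply: continuous_comp; [exact: twist_q_continuous|exact: dc].
apply: (@continuous_near _ _ _ (fun=> 0)); last exact: cst_continuous.
have : nbhs x (~` (q @^-1` gunits)).
  apply: open_nbhs_nbhs; split=> //; apply: closed_openC; apply: closed_comp.
    by move=> ? _; exact: twist_q_continuous.
  exact: gunits_closed.
by apply: filterS => y hy; rewrite diag_out.
Qed.

Lemma diag_Cc d (K : set G) : continuous d -> compact K -> K `<=` gunits ->
  (forall g, d g != 0 -> K g) -> Cc (diag E d).
Proof.
move=> dc cK Ku dK; split; [exact: diag_continuous| |exact: diag_equivariant].
apply: (@compact_support_sub _ ((fun p : G * R[i] => iota p.1 p.2) @` (K `*` circle))).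
  apply: continuous_compact; last by apply: compact_setX => //; exact: circle_compact.
  have [h _ _] := twist_iota_homeo E; apply: continuous_subspaceW h.
  by move=> [u z] /= [Ku' hz]; split => //; exact: Ku.
move=> x /diag_neq0[hx dx]; have [z hz ->] := iota_surj hx.
by exists (q x, z) => //; split=> //; exact: dK.
Qed.

Lemma Cc_mul_q (m : G -> R[i]) f : continuous m -> Cc f ->
  Cc (fun x => m (q x) * f x).
Proof.
move=> mc [fc fK fe]; split.
- move=> x; apply: cvgM; last exact: fc.
  by apply: continuous_comp; [exact: twist_q_continuous|exact: mc].
- apply: compact_support_sub fK _ => x; rewrite mulf_eq0 negb_or => /andP[_ fx].
  exact: subset_closure.
- by move=> z x hz; rewrite q_act// fe// mulrCA.
Qed.

Lemma CcD f h : Cc f -> Cc h -> Cc (fun x => f x + h x).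
Proof.
move=> [fc fK fe] [hc hK he]; split.
- by move=> x; apply: cvgD; [exact: fc|exact: hc].
- apply: compact_support_sub (compactU fK hK) _ => x fhx.
  have [fx|fx] := eqVneq (f x) 0; [right|by left; exact: subset_closure].
  by apply: subset_closure; move: fhx; rewrite fx add0r.
- by move=> z x hz; rewrite fe// he// mulrDr.
Qed.

Lemma CcZ c f : Cc f -> Cc (fun x => c * f x).
Proof.
move=> hf; apply: (@Cc_mul_q (fun=> c)) => //; exact: cst_continuous.
Qed.

Lemma Cc0 : Cc (fun _ : E => 0).
Proof.
split; first exact: cst_continuous.
  by apply: compact_support_sub compact0 _ => x; rewrite eqxx.
by move=> z x _; rewrite mulr0.
Qed.

Lemma CcB f h : Cc f -> Cc h -> Cc (fun x => f x - h x).
Proof.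
move=> hf hh; have := CcD hf (CcZ (-1) hh); congr Cc.
by apply/funext => x; rewrite mulN1r.
Qed.

Lemma involution_Cc f : Cc f -> Cc (involution f).
Proof.
move=> [fc fK fe]; split; last exact: involution_equivariant.
  move=> x; rewrite /involution; apply: continuous_comp.
    by apply: continuous_comp; [exact: ginv_continuous|exact: fc].
  exact: conjC_continuous.
apply: (@compact_support_sub _ (ginv @` closure [set x | f x != 0])).
  apply: continuous_compact fK; apply: continuous_subspaceT; exact: ginv_continuous.
move=> x; rewrite /involution fmorph_eq0 => fx; exists (ginv x); last exact: ginvK.
exact: subset_closure.
Qed.

Lemma convolution_diagl_Cc d f : continuous d -> Cc f -> Cc (convolution (diag E d) f).
Proof.
move=> dc hf.
rewrite (_ : convolution _ _ = fun x => (d \o grng) (q x) * f x); last first.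
  by apply/funext => x; rewrite convolution_diagl//; case: hf.
apply: Cc_mul_q hf => g; apply: continuous_comp; [exact: grng_continuous|exact: dc].
Qed.

Lemma convolution_diagr_Cc d f : continuous d -> Cc f -> Cc (convolution f (diag E d)).
Proof.
move=> dc hf.
rewrite (_ : convolution _ _ = fun x => (d \o gsrc) (q x) * f x); last first.
  by apply/funext => x; rewrite convolution_diagr; [exact: mulrC|case: hf].
apply: Cc_mul_q hf => g; apply: continuous_comp; [exact: gsrc_continuous|exact: dc].
Qed.

(** The sets [U i] come from a finite cover of the compact support by sets where [s] is injective,
    so each fibre of [s] meets the support in at most [N] arrows. The range map gives finiteness of
    the convolution sums; the source map gives the sparsity of columns. *)
Lemma bisection_cover (s : G -> G) f : local_homeo gunits s -> Cc f ->
  exists (N : nat) (U : nat -> set G),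
    (forall x, f x != 0 -> exists2 i, (i < N)%N & U i (q x)) /\
    (forall i g g', U i g -> U i g' -> s g = s g' -> g = g').
Proof.
move=> ls [fc fK fe].
pose P (A : set E) := exists (N : nat) (U : nat -> set G),
    (forall x, A x -> exists2 i, (i < N)%N & U i (q x)) /\
    (forall i g g', U i g -> U i g' -> s g = s g' -> g = g').
have [N [U [h1 h2]]] : P (closure [set x | f x != 0]).
  apply: (compact_ind fK).
  - by exists 0%N, (fun=> set0).
  - move=> A B AB [N [U [h1 h2]]]; exists N, U; split=> // x /AB; exact: h1.
  - move=> A B [N [U [h1 h2]]] [M [V [k1 k2]]].
    exists (N + M)%N, (fun i => if (i < N)%N then U i else V (i - N)%N); split.
      move=> x [/h1[i iN Ui]|/k1[i iM Vi]].
        by exists i; [rewrite ltn_addr|rewrite iN].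
      by exists (N + i)%N; [rewrite ltn_add2l|rewrite ltnNge leq_addr/= addKn].
    by move=> i g g'; case: ifP => _; [exact: h2|exact: k2].
  - move=> x _; have [U [oU Ux inj]] := local_homeo_injective ls (q x).
    exists (q @^-1` U).
      apply: open_nbhs_nbhs; split=> //; apply: open_comp => // ? _.
      exact: twist_q_continuous.
    by exists 1%N, (fun=> U); split=> [y Uy|i]; [exists 0%N|exact: inj].
exists N, U; split=> // x fx; apply: h1; exact: subset_closure.
Qed.

Lemma Cc_finite_range f u : Cc f ->
  finite_set [set g | grng g = u /\ f (twist_rep E g) != 0].
Proof.
move=> hf; have [N [U [h1 h2]]] := bisection_cover (@grng_local_homeo G) hf.
pose A i := [set g | grng g = u /\ U i g].
apply: (@sub_finite_set _ _ (\bigcup_(i in `I_N) A i)).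
  by move=> g [hg /h1[i iN]]; rewrite twist_repK => Ui; exists i.
apply: bigcup_finite => [|i _]; first exact: finite_II.
have [[g0 [r0 U0]]|n] := pselect (exists g, A i g).
  apply: (@sub_finite_set _ _ [set g0]) => // g [rg Ug] /=.
  by apply: (h2 i) => //; rewrite rg.
by rewrite (_ : A i = set0)//; apply/seteqP; split=> // g Ag; apply: n; exists g.
Qed.

(** Over an isolated arrow the twist is a compact open circle, on which equivariance already forces
    continuity. *)
Lemma isolated_Cc f (B : set G) : finite_set B -> (forall g, B g -> open [set g]) ->
  equivariant f -> (forall x, f x != 0 -> B (q x)) -> Cc f.
Proof.
move=> fB oB fe fB0; split=> //.
  move=> x; have [Bx|nBx] := pselect (B (q x)).
    have [U [oU Ux [phi [[_ im [p [pc pK]]] qphi aphi]]]] := twist_locally_trivial E (q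
      x).
    (* A point [y] over [q x] is [phi (q x, z)] with [z] the circle coordinate [(p y).2], and
       equivariance pulls [z] out of [f]. *)
    apply: (@continuous_near _ _ _ (fun y => (p y).2 * f (phi (q x, 1)))).
      have : nbhs x (q @^-1` [set q x]).
        apply: open_nbhs_nbhs; split=> //; apply: open_comp; last exact: oB.
        by move=> ? _; exact: twist_q_continuous.
      apply: filterS => y /= qy.
      have : (q @^-1` U) y by rewrite /preimage/= qy.
      rewrite -im => -[[g z] /= [Ug hz] e].
      have gE : g = q x by rewrite -qy -e qphi.
      have hz1 := @circle1 R.
      rewrite -e gE pK/=; last by split=> //=; rewrite -gE.
      rewrite -{1}[z]mulr1 aphi//.
      by rewrite -fe//; congr f; rewrite /twist_act qphi.
    apply: cvgM; last exact: cvg_cst.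
    have oqU : open (q @^-1` U).
      by apply: open_comp => // ? _; exact: twist_q_continuous.
    apply: continuous_comp; last exact: cvg_snd.
    exact: continuous_within_open oqU Ux pc.
  apply: (@continuous_near _ _ _ (fun=> 0)); last exact: cst_continuous.
  have clB : closed B.
    by apply: compact_closed; [exact: etale_hausdorff|exact: finite_compact].
  have : nbhs x (~` (q @^-1` B)).
    apply: open_nbhs_nbhs; split=> //; apply: closed_openC; apply: closed_comp => //.
    by move=> ? _; exact: twist_q_continuous.
  by apply: filterS => y nB; apply/eqP; apply: contra_notT nB; exact: fB0.
have cq g : compact (q @^-1` [set g]).
  have [U [oU Ug [phi [[pc im _] qphi aphi]]]] := twist_locally_trivial E g.
  rewrite (_ : _ @^-1` _ = phi @` ([set g] `*` circle)).
    apply: continuous_compact.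
      by apply: continuous_subspaceW pc => -[g' z] /= [-> ?].
    by apply: compact_setX; [exact: compact_set1|exact: circle_compact].
  apply/seteqP; split=> [x /= qx|_ [[_ z] /= [-> hz] <-]]; last exact: qphi.
  have : (q @^-1` U) x by rewrite /preimage/= qx.
  rewrite -im => -[[g' z] /= [Ug' hz] e]; exists (g', z) => //; split=> //=.
  by rewrite -qx -e qphi.
apply: (@compact_support_sub _ (q @^-1` B)) => //.
have /finite_seqP[X BX] := fB.
rewrite (_ : q @^-1` B = \big[setU/set0]_(g <- X) (q @^-1` [set g])).
  by apply: bigsetU_compact => g _; exact: cq.
rewrite -bigcup_seq BX; apply/seteqP; split=> [x hx|x [g hg /= qx]].
  by exists (q x).
by rewrite /preimage/= qx.
Qed.

End CcTheory.


(** * Lipschitz extension and norm estimates in C*-algebras *)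

(** The hypothesis makes [phi] 1-Lipschitz for the distance pulled back along [c], so McShane's
    infimum of [phi t + |a - c t|] extends it. *)
Lemma mcshane_extension (R : realType) (A : normedModType R[i]) (T : Type)
    (P : set T) (c : T -> A) (phi : T -> R) :
  (exists t, P t) ->
  (forall s t, P s -> P t -> phi s - phi t <= rn (c s - c t)) ->
  exists F : A -> R, forall a t, P t -> `|F a - phi t| <= rn (a - c t).
Proof.
move=> [t0 Pt0] lip; pose S a := [set phi t + rn (a - c t) | t in P].
have lbS a t : P t -> lbound (S a) (phi t - rn (a - c t)).
  move=> Pt _ [s Ps <-]; have := lip _ _ Pt Ps.
  by have := rn_triangle a (c t) (c s); rewrite (rn_distC (c t) a); lra.
have hS a : has_inf (S a).
  split; first by exists (phi t0 + rn (a - c t0)), t0.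
  by exists (phi t0 - rn (a - c t0)); exact: lbS.
exists (fun a => inf (S a)) => a t Pt; rewrite ler_norml; apply/andP; split.
  rewrite lerBrDr addrC; apply: lb_le_inf; first by case: (hS a).
  exact: lbS.
rewrite lerBlDr addrC; apply: ge_inf; first by case: (hS a).
by exists t.
Qed.

Section EqLimit.
Variables (R : realType) (V : normedModType R[i]).

Lemma eq_rn_lim (K : R) (x y : V) :
  (forall e : R, 0 < e -> rn (x - y) <= K * e) -> x = y.
Proof.
move=> h; apply/eqP; rewrite -subr_eq0 -rn_eq0 eq_le rn_ge0 andbT.
apply/ler_addgt0Pr => e e0; rewrite add0r.
have K0 : 0 < `|K| + 1 by rewrite ltr_wpDl.
apply: (le_trans (h _ (divr_gt0 e0 K0))).
rewrite mulrA ler_pdivrMr// mulrC ler_wpM2l// ?(ltW e0)//.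
by rewrite (le_trans (ler_norm _))// lerDl.
Qed.

Lemma rn_sqrD (x y : V) : rn (x + y) ^+ 2 <= 2 * rn x ^+ 2 + 2 * rn y ^+ 2.
Proof.
have := rnD x y; have := rn_ge0 (x + y); have := rn_ge0 x; have := rn_ge0 y.
have := sqr_ge0 (rn x - rn y).
by move: (rn x) (rn y) (rn (x + y)) => a b c; nra.
Qed.

End EqLimit.

Section CStarNorm.
Variables (R : realType) (A : cstarAlgebraType R).
Implicit Types a b : A.

Lemma rn_cmul a b : rn (cmul a b) <= rn a * rn b.
Proof. by rewrite -lecR rmorphM/= -!rnE normr_cmul. Qed.

Lemma rn_cstar_mul a : rn (cmul (cstar a) a) = rn a ^+ 2.
Proof. by apply: (@complexI R); rewrite rmorphXn/= -!rnE normr_cstar. Qed.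

Lemma rn_cstar a : rn (cstar a) = rn a.
Proof.
suff le b : rn b <= rn (cstar b) by apply/le_anti;
  rewrite le -[X in _ <= rn X]cstarK le.
have [->|b0] := eqVneq b 0; first by rewrite rn0 rn_ge0.
have b1 : 0 < rn b by rewrite lt_neqAle rn_ge0 eq_sym rn_eq0 b0.
by rewrite -(ler_pM2r b1) -expr2 -rn_cstar_mul rn_cmul.
Qed.

Lemma cmulBl a b c : cmul (a - b) c = cmul a c - cmul b c :> A.
Proof. by rewrite cmulDl -scaleN1r cmulZl scaleN1r. Qed.

Lemma cmulBr a b c : cmul a (b - c) = cmul a b - cmul a c :> A.
Proof. by rewrite cmulDr -scaleN1r cmulZr scaleN1r. Qed.

Lemma cmul0l a : cmul 0 a = 0 :> A.
Proof. by have := cmulBl 0 0 a; rewrite !subrr. Qed.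

Lemma cstarB a b : cstar (a - b) = cstar a - cstar b :> A.
Proof. by rewrite cstarD -scaleN1r cstarZ rmorphN1 scaleN1r. Qed.

Lemma rn_cmulB a b c d :
  rn (cmul a b - cmul c d) <= rn a * rn (b - d) + rn (a - c) * rn d.
Proof.
rewrite -[_ - _](subrKA (cmul a d)) -cmulBr -cmulBl.
by rewrite (le_trans (rnD _ _))// lerD// rn_cmul.
Qed.

Lemma rn_projection (p : A) : cstar p = p -> cmul p p = p -> rn p <= 1.
Proof.
move=> ps pp; have := rn_cstar_mul p; rewrite ps pp expr2.
have := rn_ge0 p; rewrite le0r => /orP[/eqP->//|p0].
by rewrite -{1}[rn p]mul1r => /(mulIf (lt0r_neq0 p0)) <-.
Qed.

End CStarNorm.

(** * Regular representations on finitely supported vectors *)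

Section RegularRepresentation.
Variables (R : realType) (G : etaleGroupoidType) (E : twist R G).
Local Notation q := (@twist_q R G E).
Local Notation rep := (@twist_rep R G E).
Implicit Types (x y : E) (z w : R[i]) (u g : G) (d : G -> R[i]) (f h : E -> R[i]).

Lemma l2_normP u h (M : R) : 0 <= M ->
  (l2_norm u h <= M%:E)%E <->
  forall s : seq G, uniq s -> (forall g, g \in s -> gsrc g = u) ->
    \sum_(g <- s) rn (h (rep g)) ^+ 2 <= M ^+ 2.
Proof.
move=> M0; have -> : M%:E = sqrte (M ^+ 2)%:E.
  by rewrite /= sqrtr_sqr ger0_norm.
rewrite /l2_norm lee_sqrt ?lee_fin ?sqr_ge0//; split.
  move=> hM s us su; rewrite -lee_fin; apply: le_trans hM; apply: esum_ge.
  exists [set` s]; first by split; [exact: finite_seq|exact: su].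
  by rewrite -fsbig_seq// sumEFin.
move=> hs; apply: ge_ereal_sup => _ [X [finX Xu] <-].
have [s Xs us] : exists2 s : seq G, X = [set` s] & uniq s.
  have /finite_seqP[s ->] := finX.
  exists (undup s); last exact: undup_uniq.
  by apply/seteqP; split=> g /=; rewrite mem_undup.
rewrite Xs -fsbig_seq// sumEFin lee_fin; apply: hs => // g gs.
by apply: Xu; rewrite Xs.
Qed.

Lemma q_rep_mul g x : grng g = grng (q x) ->
  q (gmul (ginv (rep g)) x) = gmul (ginv g) (q x).
Proof.
move=> hg; rewrite twist_q_mul ?q_inv ?twist_repK//.
by apply: composable; rewrite q_inv twist_repK gsrc_inv.
Qed.

Lemma convolution_restrict f h x (D : set G) :
  (forall g, D g -> grng g = grng (q x)) ->
  (forall g, grng g = grng (q x) -> f (rep g) != 0 -> D g) ->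
  convolution f h x = \sum_(g \in D) f (rep g) * h (gmul (ginv (rep g)) x).
Proof.
move=> Dx fD; rewrite /convolution -(@fsbig_widen _ _ _ _ D)// => g [/= hg nD].
apply/eqP; apply: contra_notT nD.
by rewrite mulf_eq0 negb_or => /andP[/fD fg _]; exact: fg.
Qed.

(** A sum over a set is 0 by convention when infinitely many of its terms are nonzero, so additivity
    is proved after restricting all three sums to one finite set. *)
Lemma convolutionBl f k h x : Cc f -> Cc k ->
  convolution f h x = convolution (fun y => f y - k y) h x + convolution k h x.
Proof.
move=> hf hk.
pose S (l : E -> R[i]) := [set g | grng g = grng (q x) /\ l (rep g) != 0].
have fS : finite_set (S f `|` S k).
  by rewrite finite_setU; split; exact: Cc_finite_range.
have SD g : (S f `|` S k) g -> grng g = grng (q x) by case=> -[].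
rewrite !(@convolution_restrict _ _ _ _ SD).
- by rewrite -fsbig_split//=; apply: eq_fsbigr => g _; rewrite -mulrDl subrK.
- by move=> g hg kg; right.
- move=> g hg fk; have [fg|fg] := eqVneq (f (rep g)) 0; last by left.
  by right; split=> //; move: fk; rewrite fg sub0r oppr_eq0.
- by move=> g hg fg; left.
Qed.

Definition truncate (T : set G) h : E -> R[i] :=
  fun x => if `[< T (q x) >] then h x else 0.

Lemma truncate_l2_space (T : set G) u h : l2_space u h ->
  (l2_norm u h <= 1)%E ->
  l2_space u (truncate T h) /\ (l2_norm u (truncate T h) <= 1)%E.
Proof.
move=> [he hu _] h1.
have le1 : (l2_norm u (truncate T h) <= 1)%E.
  apply/(l2_normP _ _ ler01) => s us su.
  have := (l2_normP u h ler01).1 h1 s us su; apply: le_trans.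
  apply: ler_sum => g _; rewrite /truncate; case: asboolP => // _.
  by rewrite rn0 expr0n/= sqr_ge0.
split=> //; split.
- by move=> z x hz; rewrite /truncate q_act//; case: asboolP; rewrite ?mulr0// he.
- by move=> x /hu hx; rewrite /truncate hx if_same.
- exact: le_lt_trans le1 (ltry _).
Qed.

(** The value at [g] involves [h] only over the products of the inverse of [a] with [g], for the
    finitely many [a] in the range fibre where [f] does not vanish. *)
Lemma convolution_truncate f h (s : seq G) : Cc f -> exists2 T : set G,
  finite_set T & forall g, g \in s ->
    convolution f h (rep g) = convolution f (truncate T h) (rep g).
Proof.
move=> hf.
pose S g := [set a | grng a = grng g /\ f (rep a) != 0].
exists (\bigcup_(g in [set` s]) [set gmul (ginv a) g | a in S g]).
  apply: bigcup_finite; first exact: finite_seq.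
  by move=> g _; apply: finite_image; exact: Cc_finite_range.
move=> g gs; apply: eq_fsbigr => a; rewrite inE/= twist_repK => ra.
have [->|fa] := eqVneq (f (rep a)) 0; first by rewrite !mul0r.
congr (_ * _); rewrite /truncate q_rep_mul twist_repK//; case: asboolP => // nT.
by exfalso; apply: nT; exists g => //; exists a.
Qed.

(** The point is that [M] does not depend on [k]: the finite set [T] alone leaves finitely many
    terms in the sum, whatever the support of [k]. *)
Lemma convolution_truncate_le (T : set G) h x : finite_set T -> exists2 M : R,
  0 <= M & forall k (e : R), (forall y, rn (k y) <= e) ->
    rn (convolution k (truncate T h) x) <= e * M.
Proof.
move=> fT.
pose S := [set a | grng a = grng (q x) /\ T (gmul (ginv a) (q x))].
have fS : finite_set S.
  apply: (@sub_finite_set _ _ [set gmul (q x) (ginv b) | b in T `&` [set b | gsrc b =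
    gsrc (q x)]]).
    move=> a [ra Ta]; exists (gmul (ginv a) (q x)); first split=> //=.
      by rewrite gsrc_mul// gsrc_inv.
    by rewrite ginv_mul ?gsrc_inv// ginvK gmulVK.
  by apply: finite_image; exact: finite_setIl.
have /finite_seqP[s0 Ss0] := fS; pose s := undup s0.
have Ss : S = [set` s] by rewrite Ss0; apply/seteqP; split=> g /=; rewrite mem_undup.
have us : uniq s by exact: undup_uniq.
exists (\sum_(a <- s) rn (truncate T h (gmul (ginv (rep a)) x))).
  by apply: sumr_ge0 => a _; exact: rn_ge0.
move=> k e ke; rewrite /convolution -(@fsbig_widen _ _ _ _ S); last 2 first.
- by move=> a [].
- move=> a [/= ra nS]; rewrite /truncate q_rep_mul//.
  by case: asboolP => [Ta|_]; [exfalso; apply: nS|rewrite mulr0].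
rewrite Ss -fsbig_seq// (le_trans (rn_sum _ _ _))// mulr_sumr.
by apply: ler_sum => a _; rewrite rnM ler_wpM2r ?rn_ge0.
Qed.

End RegularRepresentation.

(** * Evaluation of elements of the reduced algebra *)

Section ReducedAlgebra.
Variables (R : realType) (G : etaleGroupoidType) (E : twist R G).
Variable A : reduced_cstar_algebra E.
Local Notation q := (@twist_q R G E).
Local Notation rep := (@twist_rep R G E).
Local Notation cm := (completion_map A).
Implicit Types (x y : E) (z w : R[i]) (u g : G) (d : G -> R[i]) (f h k : E -> R[i]).
Implicit Types (a b : A).

Lemma cm0 : cm (fun=> 0) = 0.
Proof.
have := completion_map_linear A (-1) (Cc0 E) (Cc0 E).
rewrite (_ : (fun x => _) = fun=> 0); last by apply/funext => x; rewrite mulr0 addr0.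
by rewrite scaleN1r addNr.
Qed.

Lemma cmB f h : Cc f -> Cc h -> cm (fun x => f x - h x) = cm f - cm h.
Proof.
move=> hf hh; have := completion_map_linear A (-1) hh hf.
rewrite scaleN1r addrC => <-.
by congr cm; apply/funext => x; rewrite mulN1r addrC.
Qed.

Lemma cmD f h : Cc f -> Cc h -> cm (fun x => f x + h x) = cm f + cm h.
Proof.
move=> hf hh; have := completion_map_linear A 1 hf hh.
by rewrite scale1r => <-; congr cm; apply/funext => x; rewrite mul1r.
Qed.

Lemma cm_dense a (e : R) : 0 < e -> exists2 f, Cc f & rn (a - cm f) < e.
Proof.
move=> e0; have ec : 0 < e%:C by rewrite gtr0c.
have nb := nbhsx_ballx a e%:C ec.
have [|y [By [f hf fy]]] := @completion_map_dense _ _ _ A ((ball a e%:C)^°) _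
  (open_interior _).
  by exists a.
exists f => //; have := interior_subset By.
by rewrite -ball_normE/= -fy rnE ltcR.
Qed.

Lemma regular_rep_le u f h : Cc f -> gunits u -> l2_space u h ->
  (l2_norm u h <= 1)%E -> (l2_norm u (convolution f h) <= (rn (cm f))%:E)%E.
Proof.
move=> hf hu hh h1; rewrite completion_map_isometry//.
apply: (@le_trans _ _ (regular_rep_norm u f)).
  by apply: ereal_sup_ubound; exists h.
by apply: ereal_sup_ubound; right; exists u.
Qed.

Lemma unit_vector_l2 u : gunits u ->
  l2_space u (diag E (fun g => (g == u)%:R)) /\
  (l2_norm u (diag E (fun g => (g == u)%:R)) <= 1)%E.
Proof.
move=> hu; set h := diag E _.
have h0 x : q x <> u -> h x = 0.
  move=> /eqP xu; apply/eqP; apply/negPn/negP => /diag_neq0[_].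
  by rewrite (negbTE xu) eqxx.
have h1 : rn (h (rep u)) <= 1.
  have hq : gunits (q (rep u)) by rewrite twist_repK.
  have [z hz ->] := iota_surj hq; rewrite /h twist_repK diag_iota// eqxx mulr1.
  by rewrite rn_circle.
have le1 : (l2_norm u h <= 1)%E.
  apply/(l2_normP _ _ ler01) => s us su; rewrite expr1n.
  apply: (@le_trans _ _ (\sum_(g <- s) (if g == u then 1 else 0 : R))).
    apply: ler_sum => g _; case: eqP => [->|gu].
      by rewrite exprn_ile1// rn_ge0.
    by rewrite h0 ?twist_repK// rn0 expr0n.
  rewrite -big_mkcond/= -big_filter; have [us'|us'] := boolP (u \in s).
    by rewrite filter_pred1_uniq// big_seq1.
  rewrite big_seq big1 // => g; rewrite mem_filter => /andP[/eqP -> ].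
  by rewrite (negbTE us').
split=> //; split; first exact: diag_equivariant.
- by move=> x hx; apply: h0 => xu; apply: hx; rewrite xu.
- exact: le_lt_trans le1 (ltry _).
Qed.

(** Up to a phase, [f x] is one coefficient of the regular representation of [f] applied to the unit
    vector at the source of [x]. *)
Lemma Cc_eval_le f x : Cc f -> rn (f x) <= rn (cm f).
Proof.
move=> hf; have hu := gunits_src (q x).
have [h2 h1] := unit_vector_l2 hu.
have /(l2_normP _ _ (rn_ge0 _)) := regular_rep_le hf hu h2 h1.
move=> /(_ [:: q x] erefl); rewrite big_seq1.
rewrite convolution_diagr; last by case: hf.
rewrite !twist_repK eqxx mulr1 (@equivariant_rn _ _ _ _ _ x) ?twist_repK//;
  last by case: hf.
rewrite ler_pXn2r ?nnegrE ?rn_ge0//; apply.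
by move=> g; rewrite inE => /eqP ->.
Qed.

Lemma eval_extension x : exists J : A -> R[i],
  forall a f, Cc f -> rn (J a - f x) <= rn (a - cm f).
Proof.
have ext (phi : R[i] -> R) : (forall z w, phi z - phi w <= rn (z - w)) ->
    exists F : A -> R, forall a f, Cc f -> `|F a - phi (f x)| <= rn (a - cm f).
  move=> hphi; apply: (@mcshane_extension _ _ _ (@Cc R G E) cm (fun f => phi (f x))).
    by exists (fun=> 0); exact: Cc0.
  move=> s t hs ht; rewrite -cmB//; apply: (le_trans (hphi _ _)).
  exact: (Cc_eval_le x (CcB hs ht)).
have [|F hF] := ext (@complex.Re R).
  by move=> z w; rewrite -raddfB/= (le_trans (ler_norm _))// rn_Re.
have [|H hH] := ext (@complex.Im R).
  by move=> z w; rewrite -raddfB/= (le_trans (ler_norm _))// rn_Im.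
exists (fun a => (F a +i* H a)%C) => a f hf.
have bnd k : Cc k -> rn ((F a +i* H a)%C - k x) <= 2 * rn (a - cm k).
  move=> hk; rewrite (le_trans (rn_ReIm _))// mulr2n mulrDl !mul1r.
  by rewrite !raddfB/= lerD ?hF ?hH.
(* Extending real and imaginary parts separately costs a factor 2. Passing through an approximant
   [k] of [a] within [e / 3] restores the constant 1: the errors [2 e / 3] and [e / 3] add up to
   [e]. *)
apply: rn_le_lim => e e0; have e3 : 0 < e / 3 by rewrite divr_gt0.
have [k hk ak] := cm_dense a e3.
have := rn_triangle (k x) (F a +i* H a)%C (f x).
have := bnd k hk; have := Cc_eval_le x (CcB hk hf); rewrite cmB//.
have := rn_triangle a (cm k) (cm f); rewrite (rn_distC (cm k) a).
by lra.
Qed.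

(** The standard map from the reduced algebra to functions on the twist. [evP] and density determine
    it, so its laws are checked on approximants. *)
Definition ev a x : R[i] := sval (cid (eval_extension x)) a.

Lemma evP a f x : Cc f -> rn (ev a x - f x) <= rn (a - cm f).
Proof. by rewrite /ev; case: cid => J /= hJ; exact: hJ. Qed.

Lemma ev_cm f x : Cc f -> ev (cm f) x = f x.
Proof.
move=> hf; apply: (@eq_rn_lim _ _ 1) => e e0.
by rewrite (le_trans (evP _ x hf))// subrr rn0 mul1r ltW.
Qed.

Lemma ev_le a x : rn (ev a x) <= rn a.
Proof. by have := evP a x (Cc0 E); rewrite cm0 !subr0. Qed.

Lemma evD a b x : ev (a + b) x = ev a x + ev b x.
Proof.
apply: (@eq_rn_lim _ _ 4) => e e0.
have [f hf af] := cm_dense a e0; have [h hh bh] := cm_dense b e0.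
have h1 : rn (ev (a + b) x - (f x + h x)) <= rn (a - cm f) + rn (b - cm h).
  rewrite (le_trans (evP _ x (CcD hf hh)))// cmD// opprD addrACA; exact: rnD.
have h2 : rn (f x + h x - (ev a x + ev b x)) <= rn (a - cm f) + rn (b - cm h).
  rewrite opprD addrACA (le_trans (rnD _ _))// lerD// rn_distC; exact: evP.
have := rn_triangle (f x + h x) (ev (a + b) x) (ev a x + ev b x).
by lra.
Qed.

Lemma ev_sum n (F : 'I_n -> A) x : ev (\sum_i F i) x = \sum_i ev (F i) x.
Proof.
elim/big_rec2: _ => [|i y1 y2 _ <-]; last exact: evD.
by rewrite -cm0 ev_cm//; exact: Cc0.
Qed.

Lemma ev_diagr d a x : continuous d -> Cc (diag E d) ->
  ev (cmul a (cm (diag E d))) x = ev a x * d (gsrc (q x)).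
Proof.
move=> dc hd; apply: (@eq_rn_lim _ _ (rn (cm (diag E d)) + rn (d (gsrc (q x))))) => e
  e0.
have [f hf af] := cm_dense a e0.
have := evP (cmul a (cm (diag E d))) x (convolution_diagr_Cc dc hf).
rewrite completion_map_mul// -cmulBl convolution_diagr; last by case: hf.
have := rn_cmul (a - cm f) (cm (diag E d)).
have := rn_triangle (f x * d (gsrc (q x))) (ev (cmul a (cm (diag E d))) x) (ev a x * d
  (gsrc (q x))).
rewrite -[in X in _ <= _ + X]mulrBl rnM (rn_distC (f x)).
have := ler_wpM2r (rn_ge0 (d (gsrc (q x)))) (le_trans (evP a x hf) (ltW af)).
have := ler_wpM2r (rn_ge0 (cm (diag E d))) (ltW af).
by lra.
Qed.

(* A finitely supported vector only sees finitely many values of a function, so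
   uniformly small approximants of [a] force the regular representations of
   [a] to vanish on such vectors. *)
Lemma ev_faithful a : (forall x, ev a x = 0) -> a = 0.
Proof.
move=> a0; apply: (@eq_rn_lim _ _ 4) => e e0; rewrite subr0.
have [f hf af] := cm_dense a e0.
suff : rn (cm f) <= 3 * e.
  by have := rnD (a - cm f) (cm f); rewrite subrK; lra.
have e30 : 0 <= 3 * e by rewrite mulr_ge0// ltW.
rewrite -lee_fin completion_map_isometry//.
apply: ge_ereal_sup => _ [->|[u hu <-]]; first by rewrite lee_fin.
apply: ge_ereal_sup => _ [h [hh h1] <-].
apply/(l2_normP _ _ e30) => s us su.
have [T fT hT] := convolution_truncate h s hf.
have [hh' h1'] := truncate_l2_space T hh h1.
pose M x := sval (cid2 (@convolution_truncate_le _ _ E T h x fT)).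
have M0 x : 0 <= M x by rewrite /M; case: cid2.
have kM k x (c : R) : (forall y, rn (k y) <= c) ->
    rn (convolution k (truncate T h) x) <= c * M x.
  by rewrite /M; case: cid2 => m /= _; apply.
pose C := \sum_(g <- s) M (rep g) ^+ 2.
have C0 : 0 <= C by apply: sumr_ge0 => g _; exact: sqr_ge0.
have C1 : 0 < 1 + 2 * C by rewrite ltr_pwDl// mulr_ge0.
(* This choice gives [t <= e] and [t ^+ 2 * C <= e ^+ 2 / 2], so the squared estimate
   [2 (e + t)^2 + 2 t^2 C] is at most [9 e^2]; hence the bound [3 * e]. *)
pose t := e / (1 + 2 * C).
have t0 : 0 < t by rewrite divr_gt0.
have te : t * (1 + 2 * C) = e by rewrite divfK// gt_eqF.
have [k hk ak] := cm_dense a t0.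
have kx y : rn (k y) <= t.
  by have := evP a y hk; rewrite a0 sub0r rnN => /le_trans; apply; exact: ltW.
have hfk := CcB hf hk.
have nfk : rn (cm (fun y => f y - k y)) <= e + t.
  rewrite cmB//; have := rn_triangle a (cm f) (cm k); rewrite (rn_distC (cm f) a).
  by lra.
have et0 : 0 <= e + t by rewrite addr_ge0// ltW.
have /(l2_normP _ _ et0)/(_ s us su) b1 :
    (l2_norm u (convolution (fun y => f y - k y)%R (truncate T h)) <= (e + t)%:E)%E.
  by apply: le_trans (regular_rep_le hfk hu hh' h1') _; rewrite lee_fin.
apply: (@le_trans _ _ (2 * \sum_(g <- s) rn (convolution (fun y => f y - k y)
    (truncate T h) (rep g)) ^+ 2 + 2 * (t ^+ 2 * C))).
  rewrite !mulr_sumr -big_split/=; rewrite big_seq [leRHS]big_seq.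
  apply: ler_sum => g gs; rewrite /regular_rep hT// (convolutionBl _ _ hf hk).
  apply: (le_trans (rn_sqrD _ _)); rewrite lerD2l ler_wpM2l// -exprMn.
  by apply: lerXn2r (kM _ _ _ kx); [exact: rn_ge0|exact: mulr_ge0 (ltW t0) (M0 _)].
move: b1; set S := \sum_(g <- s) _ => b1.
have tle : t <= e by rewrite -te ler_peMr ?(ltW t0)// lerDl mulr_ge0.
have : t ^+ 2 * C <= e ^+ 2 / 2.
  have : t * C <= e / 2 by rewrite -te; have := ltW t0; nra.
  by move=> tC; have := ler_pM (ltW t0) (mulr_ge0 (ltW t0) C0) tle tC; lra.
have : (e + t) ^+ 2 <= (2 * e) ^+ 2 by rewrite ler_pXn2r ?nnegrE ?mulr_ge0 ?(ltW e0)//;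
  lra.
by lra.
Qed.

End ReducedAlgebra.


(** * Orthonormal families and rank one operators *)

Section HilbertNorm.
Variables (R : realType) (H : hilbertType R).
Implicit Types (x y : H) (c : R[i]).

Lemma rn_sqr x : (rn x ^+ 2)%:C = inner x x.
Proof. by rewrite rmorphXn/= -rnE sqr_normE. Qed.

Lemma inner0l y : inner (0 : H) y = 0. Proof. exact: linear0l. Qed.

Lemma inner0r x : inner x (0 : H) = 0. Proof. exact: linear0r. Qed.

Lemma inner_suml (I : Type) (r : seq I) (P : pred I) (F : I -> H) y :
  inner (\sum_(i <- r | P i) F i) y = \sum_(i <- r | P i) inner (F i) y.
Proof.
elim/big_rec2: _ => [|i a b _ <-]; [exact: inner0l|exact: innerDl].
Qed.

Lemma inner_sumr (I : Type) (r : seq I) (P : pred I) (F : I -> H) x :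
  inner x (\sum_(i <- r | P i) F i) = \sum_(i <- r | P i) inner x (F i).
Proof.
elim/big_rec2: _ => [|i a b _ <-]; [exact: inner0r|exact: innerDr].
Qed.

Lemma pythagoras x y : inner x y = 0 -> rn (x + y) ^+ 2 = rn x ^+ 2 + rn y ^+ 2.
Proof.
move=> xy; apply: (@complexI R); rewrite rmorphD/= !rn_sqr innerDl !innerDr xy.
by rewrite (innerC y x) xy rmorph0 addr0 add0r.
Qed.

Lemma rn_normalize x : x != 0 -> rn ((rn x)^-1%:C *: x) = 1.
Proof.
move=> x0; have n0 : rn x != 0 by rewrite rn_eq0.
rewrite rnZ -/(rn _) rn_real ger0_norm ?invr_ge0 ?rn_ge0// mulVf//.
Qed.

End HilbertNorm.

Section Orthonormal.
Variables (R : realType) (H : hilbertType R).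
Implicit Types (x y : H) (e : nat -> H) (c : nat -> R[i]).

Definition orthonormal_upto e n :=
  forall i j, (i < n)%N -> (j < n)%N -> inner (e i) (e j) = (i == j)%:R.

Lemma inner_orthonormal_sum e n c j : orthonormal_upto e n -> (j < n)%N ->
  inner (\sum_(i < n) c i *: e i) (e j) = c j.
Proof.
move=> oe jn; rewrite inner_suml (bigD1 (Ordinal jn))//= innerZl oe// eqxx mulr1.
rewrite big1 ?addr0// => i ij; rewrite innerZl oe//.
by rewrite (_ : (i == j :> nat) = false) ?mulr0//; apply/negbTE.
Qed.

Lemma rn_orthonormal_sum e n c : orthonormal_upto e n ->
  rn (\sum_(i < n) c i *: e i) ^+ 2 = \sum_(i < n) rn (c i) ^+ 2.
Proof.
move=> oe; apply: (@complexI R); rewrite rn_sqr rmorph_sum/= inner_sumr.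
by apply: eq_bigr => i _; rewrite innerZr inner_orthonormal_sum// mulrC mul_conj.
Qed.

Lemma bessel e n x : orthonormal_upto e n ->
  \sum_(i < n) rn (inner x (e i)) ^+ 2 <= rn x ^+ 2.
Proof.
move=> oe; set y := \sum_(i < n) inner x (e i) *: e i.
have xy : inner (x - y) y = 0.
  rewrite inner_sumr big1// => i _; rewrite innerZr innerBl.
  by rewrite (inner_orthonormal_sum (fun i => inner x (e i)))// subrr mulr0.
rewrite -(rn_orthonormal_sum (fun i => inner x (e i)) oe) -/y.
by rewrite -[in leRHS](subrK y x) pythagoras// lerDr sqr_ge0.
Qed.

Definition finitely_spanned (K : set H) := exists n e,
  forall x, K x -> exists c, x = \sum_(i < n) c i *: e i.

(** Gram-Schmidt: a vector of [K] outside the span of the family found so far, minus its projection,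
    is nonzero and gives the next member. *)
Lemma orthonormal_or_spanned (K : set H) n :
  (forall a x y, K x -> K y -> K (a *: x + y)) -> K 0 ->
  (exists2 e, orthonormal_upto e n & forall i, (i < n)%N -> K (e i)) \/
  finitely_spanned K.
Proof.
move=> Klin K0; elim: n => [|n [[e oe Ke]|]]; [by left; exists (fun=> 0)| |by right].
have [|/existsNP[x /not_implyP[Kx nx]]] := pselect (forall x, K x ->
    exists c, x = \sum_(i < n) c i *: e i); first by right; exists n, e.
left; set y := \sum_(i < n) inner x (e i) *: e i.
have Ky : K (x - y).
  have : forall m, (m <= n)%N -> K (- \sum_(i < m) inner x (e i) *: e i).
    elim=> [|m IH mn]; first by rewrite big_ord0 oppr0.
    by rewrite big_ord_recr/= opprD addrC -scaleNr;
      apply: Klin (Ke _ mn) (IH (ltnW mn)).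
  by move=> /(_ n (leqnn n)) Ky; have := Klin 1 _ _ Kx Ky; rewrite scale1r.
have xy0 : x - y != 0.
  by apply: contra_notN nx; rewrite subr_eq0 => /eqP xy;
    exists (fun i => inner x (e i)).
have ye j : (j < n)%N -> inner (x - y) (e j) = 0.
  by move=> jn; rewrite innerBl (inner_orthonormal_sum (fun i => inner x (e i)))//
    subrr.
pose v := (rn (x - y))^-1%:C *: (x - y).
have ve j : (j < n)%N -> inner v (e j) = 0 by move=> jn; rewrite innerZl ye// mulr0.
have vv : inner v v = 1 by rewrite -rn_sqr rn_normalize// expr1n.
exists (fun i => if (i < n)%N then e i else v).
  move=> i j; rewrite !ltnS => iN jN; case: ltnP => [ilt|ige]; case: ltnP => [jlt|jge].
  - exact: oe.
  - rewrite innerC ve// rmorph0 (_ : i == j = false)//.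
    by apply/negbTE; rewrite neq_ltn (leq_trans ilt jge).
  - rewrite ve// (_ : i == j = false)//.
    by apply/negbTE; rewrite neq_ltn (leq_trans jlt ige) orbT.
  - by rewrite vv (_ : i = j) ?eqxx//; apply/eqP;
    rewrite eqn_leq (leq_trans iN jge) (leq_trans jN ige).
move=> i _; case: ltnP => [/Ke//|_].
by have := Klin (rn (x - y))^-1%:C _ _ Ky K0; rewrite addr0.
Qed.

Lemma finitely_spannedD (K L : set H) : finitely_spanned K -> finitely_spanned L ->
  finitely_spanned [set x + y | x in K & y in L].
Proof.
move=> [n [e he]] [m [f hf]].
exists (n + m)%N, (fun i => if (i < n)%N then e i else f (i - n)%N).
move=> _ [x /he[c ->] [y /hf[d ->] <-]].
exists (fun i => if (i < n)%N then c i else d (i - n)%N).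
rewrite big_split_ord/=; congr (_ + _); apply: eq_bigr => i _; first by rewrite ltn_ord.
by rewrite ltnNge leq_addr/= addKn.
Qed.

Lemma sum_ordB (V : zmodType) (F : nat -> V) (M N : nat) : (M <= N)%N ->
  \sum_(i < N) F i - \sum_(i < M) F i = \sum_(i < N) (if (i < M)%N then 0 else F i).
Proof.
move=> MN; rewrite (big_ord_widen N F MN).
rewrite [X in X - _](bigID (fun i : 'I_N => (i < M)%N))/= addrAC subrr add0r.
by rewrite big_mkcond/=; apply: eq_bigr => i _; case: (i < M)%N.
Qed.

(* The isometry between the closed spans, extended by 0. *)
Lemma orthonormal_transfer (f w : nat -> H) :
  (forall n, orthonormal_upto f n) -> (forall n, orthonormal_upto w n) ->
  exists T : bounded_operator H, forall n, T (f n) = w n.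
Proof.
move=> of_ ow.
pose S (N : nat) x := \sum_(i < N) inner x (f i) *: w i.
pose b (N : nat) x := \sum_(i < N) rn (inner x (f i)) ^+ 2.
have bS M N x : (M <= N)%N -> rn (S N x - S M x) ^+ 2 = b N x - b M x.
  move=> MN; rewrite /S /b (sum_ordB (fun i => inner x (f i) *: w i) MN)
    (sum_ordB (fun i => rn (inner x (f i)) ^+ 2) MN).
  pose c i := if (i < M)%N then 0 else inner x (f i).
  rewrite (_ : \sum_(i < N) _ = \sum_(i < N) c i *: w i); last first.
    by apply: eq_bigr => i _; rewrite /c; case: ifP; rewrite ?scale0r.
  rewrite rn_orthonormal_sum//; apply: eq_bigr => i _; rewrite /c.
  by case: ifP => // _; rewrite rn0 expr0n.
have bx N x : b N x <= rn x ^+ 2 by exact: bessel.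
have SN N x : rn (S N x) <= rn x.
  by rewrite -(@ler_pXn2r _ 2)// ?nnegrE ?rn_ge0//
    (rn_orthonormal_sum (fun i => inner x (f i)) (ow N)); exact: bx.
(* By Bessel the increasing sequence [b N x] is bounded; beyond an index where it is within [r ^+ 2]
   of its supremum, [S N x] varies by less than [r]. *)
have Sx x : cvg ((fun N => S N x) @ \oo).
  apply: cauchy_cvg; apply/cauchyP => e e0.
  have [r er] : exists r : R, e = r%:C by apply/complex_realP; rewrite gtr0_real.
  move: e0; rewrite er gtr0c => e0.
  have hs : has_sup (range (fun N => b N x)).
    split; first by exists (b 0%N x), 0%N.
    by exists (rn x ^+ 2) => _ [N _ <-].
  have e2 : 0 < r ^+ 2 by rewrite exprn_gt0.
  have [_ [M _ <-] hM] := sup_adherent e2 hs.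
  exists (S M x); exists M => // N /= MN; rewrite -ball_normE/= rnE ltcR.
  rewrite rn_distC -(@ltr_pXn2r _ 2)// ?nnegrE ?rn_ge0 ?(ltW e0)// bS//.
  have : b N x <= sup (range (fun N => b N x)).
    by apply: ub_le_sup; [case: hs|exists N].
  by lra.
pose L x := lim ((fun N => S N x) @ \oo).
have Lx x : (fun N => S N x) @ \oo --> L x by exact: Sx.
have Llin : linear L.
  move=> c x y; apply: cvg_lim => //.
  rewrite (_ : (fun N => _) = fun N => c *: S N x + S N y); last first.
    apply/funext => N; rewrite /S scaler_sumr -big_split/=; apply: eq_bigr => i _.
    by rewrite innerDl innerZl scalerDl scalerA.
  by apply: cvgD; [exact: cvgZr|].
have Lb : (L : H -> H) \in @bounded_linear R H.
  apply/asboolP; split=> //; exists 1 => x; rewrite mul1r.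
  apply: le_complexP => // e e0.
  have h : \forall N \near \oo, `|L x - S N x| <= e%:C.
    by apply: ((@cvgrPdist_le _ _ _ _ _ _ _).1 (Lx x)); rewrite gtr0c.
  have [N hN] := filter_ex h.
  rewrite -[L x](subrK (S N x)) (le_trans (ler_normD _ _))// addrC lerD//.
  by rewrite !rnE lecR.
exists (BoundedOperator Lb) => n; apply: cvg_lim => //=.
apply: cvg_near_cst; exists n.+1 => // N /= nN.
rewrite /S (bigD1 (Ordinal nN))//= (of_ N n n)// eqxx scale1r big1 ?addr0// => i ni.
by rewrite (of_ N n i)// (_ : (n == i :> nat) = false) ?scale0r//; apply/negbTE;
  rewrite eq_sym.
Qed.

End Orthonormal.

Section RankOne.
Variables (R : realType) (H : hilbertType R).
Implicit Types (x y a b : H) (T : bounded_operator H).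

Lemma rank_one_subproof a b : (fun x : H => inner x b *: a) \in @bounded_linear R H.
Proof.
apply/asboolP; split=> [c x y|]; first by rewrite innerDl innerZl scalerDl scalerA.
exists (`|b| * `|a|) => x; rewrite normrZ mulrAC ler_wpM2r// mulrC.
exact: cauchy_schwarz.
Qed.

Definition rank_one a b : bounded_operator H := BoundedOperator (rank_one_subproof a b).

Lemma cmulE (S T : bounded_operator H) x : (cmul S T : bounded_operator H) x = S (T x).
Proof. by []. Qed.

Lemma cstarE T x y : inner (T x) y = inner x ((cstar T : bounded_operator H) y).
Proof. exact: bo_adjointE. Qed.

Lemma rank_one_star a b : cstar (rank_one a b) = rank_one b a.
Proof.
by apply: bo_adjointP => x y /=; rewrite innerZl innerZr -innerC mulrC.
Qed.

Lemma rank_one_mul a b c d :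
  cmul (rank_one a b) (rank_one c d) = inner c b *: rank_one a d.
Proof.
apply: bo_eqP => x.
change (inner (inner x d *: c) b *: a = inner c b *: (inner x d *: a)).
by rewrite innerZl scalerA mulrC.
Qed.

Lemma mul_rank_one T a b : cmul T (rank_one a b) = rank_one (T a) b.
Proof. by apply: bo_eqP => x /=; rewrite linearZ. Qed.

Lemma rank_one_mul_adj T a b : cmul (rank_one a b) (cstar T) = rank_one a (T b).
Proof.
by apply: bo_eqP => x /=; rewrite -(bo_adjointEr T).
Qed.

Lemma rank_one_eq0 a : rank_one a a = 0 -> a = 0.
Proof.
move=> h; apply/eqP; rewrite -normr_eq0 -sqrf_eq0 sqr_normE.
have := congr1 (fun T : bounded_operator H => T a) h => /= /eqP.
by rewrite scaler_eq0 => /orP[//|/eqP ->]; rewrite inner0l.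
Qed.

Lemma rank_one0 b : rank_one 0 b = 0.
Proof. by apply: bo_eqP => x /=; rewrite scaler0. Qed.

End RankOne.

Section CStarNormOnOperators.
Variables (R : realType) (H : hilbertType R) (A : cstarAlgebraType R).
Variable phi : {linear bounded_operator H -> A}.
Hypotheses (phi_inj : injective phi)
  (phiM : forall S T : bounded_operator H, phi (cmul S T) = cmul (phi S) (phi T))
  (phiS : forall T : bounded_operator H, phi (cstar T) = cstar (phi T)).
Implicit Types (a b : H) (T P : bounded_operator H).

Lemma phi_projection P : cstar P = P -> cmul P P = P -> rn (phi P) <= 1.
Proof. by move=> Ps PP; apply: rn_projection; rewrite -?phiS -?phiM ?Ps ?PP. Qed.

(** The square of [rank_one a a] is [|a|^2] times itself, so the C*-identity yields
    [|phi e|^2 = |a|^2 |phi e|]; injectivity of [phi] allows the cancellation. *)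
Lemma phi_rank_one_self a : rn (phi (rank_one a a)) = rn a ^+ 2.
Proof.
have [->|a0] := eqVneq a 0.
  by rewrite rank_one0 linear0 !rn0 expr0n.
have n0 : rn (phi (rank_one a a)) != 0.
  rewrite rn_eq0; apply: contra_neq a0 => h; apply: rank_one_eq0.
  by apply: phi_inj; rewrite h linear0.
apply: (mulIf n0); rewrite -expr2 -rn_cstar_mul -phiS -phiM rank_one_star.
by rewrite rank_one_mul linearZ rnZ -rn_sqr -/(rn _) rn_real ger0_norm ?sqr_ge0.
Qed.

Lemma phi_rank_one a b : rn (phi (rank_one a b)) = rn a * rn b.
Proof.
apply/eqP; rewrite -(@eqrXn2 _ 2) ?rn_ge0 ?mulr_ge0 ?rn_ge0//; apply/eqP.
rewrite -rn_cstar_mul -phiS -phiM rank_one_star rank_one_mul linearZ rnZ.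
rewrite phi_rank_one_self -rn_sqr -/(rn _) rn_real ger0_norm ?sqr_ge0//.
by rewrite exprMn.
Qed.

End CStarNormOnOperators.


(** * Real functions on the unit space and point masses *)

Section RealDiagonal.
Variables (R : realType) (G : etaleGroupoidType) (E : twist R G).
Variable A : reduced_cstar_algebra E.
Local Notation q := (@twist_q R G E).
Local Notation iota := (@twist_iota R G E).
Local Notation cm := (completion_map A).
Implicit Types (x y : E) (u v g : G) (d : G -> R) (f h : E -> R[i]) (K V : set G).

Definition rdiag d : E -> R[i] := diag E (fun g => (d g)%:C).

Definition supported_in V d := exists K, [/\ compact K, K `<=` V & forall g, d g != 0
  -> K g].

Lemma real_complex_comp_continuous d : continuous d ->
  continuous (fun g => (d g)%:C : R[i]).
Proof.
by move=> dc g; apply: continuous_comp; [exact: dc|exact: real_complex_continuous].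
Qed.

Lemma rdiag_Cc d : continuous d -> supported_in gunits d -> Cc (rdiag d).
Proof.
move=> dc [K [cK Ku dK]]; apply: diag_Cc cK Ku _.
  exact: real_complex_comp_continuous.
by move=> g dg; apply: dK; apply: contra_neq dg => ->.
Qed.

Lemma rdiag_star d : Cc (rdiag d) -> cstar (cm (rdiag d)) = cm (rdiag d).
Proof.
move=> hd; rewrite -completion_map_star//; congr cm; apply/funext => x.
rewrite involution_diag /rdiag; congr diag; apply/funext => g.
exact: conjc_real.
Qed.

Lemma rdiagM d d' : Cc (rdiag d) -> Cc (rdiag d') ->
  cmul (cm (rdiag d)) (cm (rdiag d')) = cm (rdiag (fun g => d g * d' g)).
Proof.
move=> hd hd'; rewrite -completion_map_mul//; congr cm; apply/funext => x.
rewrite convolution_diagl; last by case: hd'.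
have [hx|hx] := pselect (gunits (q x)); last by rewrite /rdiag !diag_out ?mulr0.
have [z hz ->] := iota_surj hx.
by rewrite /rdiag !diag_iota// twist_q_iota// grng_unit// rmorphM/= mulrCA.
Qed.

Lemma rdiag_lin (r : R) d d' x :
  rdiag (fun g => r * d g + d' g) x = r%:C * rdiag d x + rdiag d' x.
Proof.
rewrite /rdiag; have [hx|hx] := pselect (gunits (q x)); last first.
  by rewrite !diag_out// mulr0 addr0.
have [z hz ->] := iota_surj hx.
by rewrite !diag_iota// rmorphD rmorphM/= mulrDr mulrCA.
Qed.

Lemma cm_rdiag_lin (r : R) d d' : Cc (rdiag d) -> Cc (rdiag d') ->
  cm (rdiag (fun g => r * d g + d' g)) = r%:C *: cm (rdiag d) + cm (rdiag d').
Proof.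
move=> hd hd'; rewrite -completion_map_linear//; congr cm; apply/funext => x.
exact: rdiag_lin.
Qed.

Lemma rdiag0 : rdiag (fun=> 0) = fun=> 0.
Proof.
by apply/funext => x; rewrite /rdiag /diag; case: asboolP => // _; rewrite mulr0.
Qed.

Definition unit_mass u : G -> R := fun g => (g == u)%:R.

Lemma unit_mass_continuous u : open [set u] -> continuous (unit_mass u).
Proof.
move=> ou g; have [->|gu] := eqVneq g u.
  apply: (@continuous_near _ R _ (fun=> 1)); last exact: cst_continuous.
  apply: filterS (open_nbhs_nbhs (conj ou erefl)) => y /= ->.
  by rewrite /unit_mass eqxx.
apply: (@continuous_near _ R _ (fun=> 0)); last exact: cst_continuous.
have clu : closed [set u].
  by apply: accessible_closed_set1; apply: hausdorff_accessible; exact: etale_hausdorff.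
have : nbhs g (~` [set u]).
  apply: open_nbhs_nbhs; split; first exact: closed_openC.
  by move=> /= gu'; rewrite gu' eqxx in gu.
by apply: filterS => y /= /eqP/negbTE yu; rewrite /unit_mass yu.
Qed.

Lemma unit_mass_supported u V : V u -> supported_in V (unit_mass u).
Proof.
move=> Vu; exists [set u]; split; [exact: compact_set1|by move=> _ ->|].
by move=> g; rewrite /unit_mass; case: (g =P u) => [->//|_]; rewrite eqxx.
Qed.

Lemma unit_mass_Cc u : gunits u -> open [set u] -> Cc (rdiag (unit_mass u)).
Proof.
by move=> hu ou; apply: rdiag_Cc;
  [exact: unit_mass_continuous|exact: unit_mass_supported].
Qed.

End RealDiagonal.

(** * Action of the diagonal on H and existence of isolated units *)

Section Isomorphism.
Variables (R : realType) (H : hilbertType R) (G : etaleGroupoidType).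
Variables (E : twist R G) (A : reduced_cstar_algebra E).
Variables (phi : {linear bounded_operator H -> A}) (psi : A -> bounded_operator H).
Hypotheses (phiK : cancel phi psi) (psiK : cancel psi phi)
  (phiM : forall S T : bounded_operator H, phi (cmul S T) = cmul (phi S) (phi T))
  (phiS : forall T : bounded_operator H, phi (cstar T) = cstar (phi T)).
Local Notation q := (@twist_q R G E).
Local Notation iota := (@twist_iota R G E).
Local Notation cm := (completion_map A).
Local Notation rdiag := (@rdiag R G E).
Implicit Types (x y : E) (u v g : G) (d : G -> R) (f h : E -> R[i]) (K V : set G).
Implicit Types (a b : A) (xi eta : H).

Let phi_inj : injective phi := can_inj phiK.

Lemma psiM a b : psi (cmul a b) = cmul (psi a) (psi b).
Proof. by apply: phi_inj; rewrite phiM !psiK. Qed.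

Lemma psiS a : psi (cstar a) = cstar (psi a).
Proof. by apply: phi_inj; rewrite phiS !psiK. Qed.

Lemma psi_lin (c : R[i]) a b : psi (c *: a + b) = c *: psi a + psi b.
Proof. by apply: phi_inj; rewrite linearP !psiK. Qed.

Lemma psi0 : psi 0 = 0.
Proof. by apply: phi_inj; rewrite psiK linear0. Qed.

Definition op d : bounded_operator H := psi (cm (rdiag d)).

Lemma op_self d xi eta : Cc (rdiag d) -> inner (op d xi) eta = inner xi (op d eta).
Proof. by move=> hd; rewrite cstarE -psiS rdiag_star. Qed.

Lemma op_star d : Cc (rdiag d) -> cstar (op d) = op d.
Proof. by move=> hd; rewrite -psiS rdiag_star. Qed.

Lemma opM d d' xi : Cc (rdiag d) -> Cc (rdiag d') ->
  op d (op d' xi) = op (fun g => d g * d' g) xi.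
Proof. by move=> hd hd'; rewrite -cmulE -psiM rdiagM. Qed.

Lemma op_lin (r : R) d d' xi : Cc (rdiag d) -> Cc (rdiag d') ->
  op (fun g => r * d g + d' g) xi = r%:C *: op d xi + op d' xi.
Proof. by move=> hd hd'; rewrite /op cm_rdiag_lin// psi_lin. Qed.

Lemma op0 xi : op (fun=> 0) xi = 0.
Proof. by rewrite /op rdiag0 cm0 psi0. Qed.

(* With [s = 1 - sqrt (1 - d^2)], which has the support of [d], one has
   [(1 - s)^2 = 1 - d^2], so that [|d xi|^2 = |xi|^2 - |xi - s xi|^2]. *)
Lemma op_contraction d xi : continuous d -> supported_in gunits d ->
  (forall g, 0 <= d g <= 1) -> rn (op d xi) <= rn xi.
Proof.
move=> dc dK d01; have hd := @rdiag_Cc _ _ E d dc dK.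
pose s g := 1 - Num.sqrt (1 - d g * d g).
have sc : continuous s.
  move=> g; apply: cvgB; first exact: cvg_cst.
  apply: continuous_comp; last exact: sqrt_continuous.
  apply: cvgB; first exact: cvg_cst.
  by apply: cvgM; exact: dc.
have hs : Cc (rdiag s).
  apply: rdiag_Cc => //; case: dK => K [cK Ku dK]; exists K; split=> // g sg.
  apply: dK; apply: contra_neq sg => dg.
  by rewrite /s dg mulr0 subr0 sqrtr1 subrr.
have ss g : s g * s g = 2 * s g + (-1 * (d g * d g) + 0).
  have h : 0 <= 1 - d g * d g.
    by have /andP[d0 d1] := d01 g; rewrite subr_ge0 mulr_ile1.
  by have := sqr_sqrtr h; rewrite /s; move: (Num.sqrt _) => t; rewrite expr2; lra.
have h0 : Cc (rdiag (fun=> 0)) by rewrite rdiag0; exact: Cc0.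
have hdd : Cc (rdiag (fun g => d g * d g)).
  apply: rdiag_Cc; first by move=> g; apply: cvgM; exact: dc.
  case: dK => K [cK Ku dK]; exists K; split=> // g.
  by rewrite mulf_eq0 negb_or => /andP[/dK].
have hdd' : Cc (rdiag (fun g => -1 * (d g * d g) + 0)).
  have := CcD (CcZ (-1)%:C hdd) h0; congr Cc.
  by apply/funext => x; rewrite rdiag_lin.
have e : op s (op s xi) = 2%:C *: op s xi - op d (op d xi).
  rewrite !opM// (_ : (fun g => s g * s g) = fun g => 2 * s g + (-1 * (d g * d g) + 0)).
    by rewrite op_lin// op_lin// op0 addr0 rmorphN1 scaleN1r.
  by apply/funext.
have e1 : inner xi (op s xi) = inner (op s xi) xi by rewrite op_self.
have e2 : inner (op s xi) (op s xi) =
    2%:C * inner (op s xi) xi - inner (op d xi) (op d xi).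
  by rewrite -(op_self (op s xi) xi)// e innerBl innerZl (op_self (op d xi)).
have : (rn (xi - op s xi) ^+ 2)%:C = (rn xi ^+ 2 - rn (op d xi) ^+ 2)%:C :> R[i].
  rewrite rmorphB/= !rn_sqr innerBl !innerBr e1 e2 rmorph_nat.
  by ring.
move=> /complexI h; rewrite -(@ler_pXn2r _ 2) ?nnegrE ?rn_ge0//.
by rewrite -subr_ge0 -h sqr_ge0.
Qed.

(** Since [op d] is self-adjoint, [rank_one xi xi] times [op d] is [rank_one xi (op d xi)]. Its
    image has norm [rn xi * rn (op d xi)], which dominates its value at [x]. *)
Lemma ev_mul_op xi d x : continuous d -> Cc (rdiag d) ->
  rn (ev (phi (rank_one xi xi)) x) * `|d (gsrc (q x))| <= rn xi * rn (op d xi).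
Proof.
move=> dc hd; rewrite -rn_real -rnM.
rewrite -(ev_diagr _ _ (real_complex_comp_continuous dc) hd).
rewrite (le_trans (ev_le _ _))// -[X in cmul _ X]psiK -phiM -/(op d).
have := rank_one_mul_adj (op d) xi xi; rewrite op_star// => ->.
by rewrite (phi_rank_one phi_inj phiM phiS).
Qed.

Lemma ev_rank_one_neq0 xi : xi != 0 -> exists x, ev (phi (rank_one xi xi)) x != 0.
Proof.
move=> xi0; apply: contrapT => /forallNP h.
have : phi (rank_one xi xi) = 0.
  by apply: ev_faithful => x; apply/eqP/negP => /negP; exact: h.
rewrite -[0](linear0 phi) => /phi_inj/rank_one_eq0 xi0'.
by rewrite xi0' eqxx in xi0.
Qed.

Lemma ev_bounded_below a x0 : ev a x0 != 0 -> exists W : set G,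
  [/\ open W, W (gsrc (q x0)), W `<=` gunits &
      forall u, W u -> exists2 x, gsrc (q x) = u & rn (ev a x0) / 4 <= rn (ev a x)].
Proof.
move=> h0; set c := rn (ev a x0).
have c0 : 0 < c / 4 by rewrite divr_gt0// lt_neqAle rn_ge0 eq_sym rn_eq0 h0.
(* Going from [ev a x0] to [ev a x] costs three errors, each at most [c / 4]: two approximations by
   [f] and the variation of [f] on [O]. A quarter of [c] remains. *)
have [f hf af] := cm_dense a c0.
pose O := f @^-1` (ball (f x0) (c / 4)%:C)^°.
have oO : open O.
  apply: open_comp; last exact: open_interior.
  by move=> ? _; case: hf => fc _ _; exact: fc.
have Ox0 : O x0 by apply: nbhsx_ballx; rewrite gtr0c.
exists (gsrc @` (q @` O)); split.
- apply: (local_homeo_open (@gsrc_local_homeo G)); first exact: gunits_open.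
  exact: twist_q_open.
- by exists (q x0) => //; exists x0.
- by move=> _ [g _ <-]; exact: gunits_src.
move=> _ [_ [x /interior_subset Bx <-] <-]; exists x => //.
move: Bx; rewrite -ball_normE/= rnE ltcR => Bx.
have := evP a x0 hf; have := evP a x hf.
have := rnD (ev a x0 - f x0) (f x0 - f x); rewrite subrKA.
have := rnD (ev a x0 - f x) (f x - ev a x); rewrite subrKA (rn_distC (f x)).
have := rnD (ev a x0 - ev a x) (ev a x); rewrite subrK -/c.
by lra.
Qed.

(* Without isolated points, an open set could be split again and again into
   disjoint pieces, each carrying a fixed amount of the norm of [xi]. *)
Lemma exists_isolated xi : xi != 0 ->
  exists u, [/\ gunits u, open [set u] & op (unit_mass R u) xi != 0].
Proof.
move=> xi0; have [x0 e0] := ev_rank_one_neq0 xi0.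
have [W [oW Wx0 Wu We]] := ev_bounded_below e0.
have n0 : 0 < rn xi by rewrite lt_neqAle rn_ge0 eq_sym rn_eq0 xi0.
set c := rn (ev _ x0) / 4 in We.
have c0 : 0 < c by rewrite divr_gt0// lt_neqAle rn_ge0 eq_sym rn_eq0 e0.
have key u d : W u -> d u = 1 -> continuous d -> Cc (rdiag d) ->
    c / rn xi <= rn (op d xi).
  move=> /We[x xu cx] du dc hd; rewrite ler_pdivrMr// mulrC.
  have := ev_mul_op xi x dc hd; rewrite xu du normr1 mulr1.
  exact: le_trans.
set t := c / rn xi in key; have t0 : 0 < t by rewrite divr_gt0.
apply: contrapT => /forallNP noiso.
(* The point mass at an isolated unit of [W] would itself be an admissible bump, moving [xi] to a
   vector of norm at least [t]. *)
have Wni u : W u -> ~ open [set u].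
  move=> Wu' ou; apply: (noiso u); split=> //; first exact: Wu.
  rewrite -rn_eq0 gt_eqF// (lt_le_trans t0)//.
  apply: (key u) => //; first by rewrite /unit_mass eqxx.
    exact: unit_mass_continuous.
  by apply: unit_mass_Cc => //; exact: Wu.
(* The exponent [k] counts splittings: bumps with disjoint supports send [xi] to orthogonal vectors,
   so each splitting doubles the lower bound, while [op_contraction] caps it by [rn xi ^+ 2]. *)
pose good V d k := [/\ continuous d, (forall g, 0 <= d g <= 1), supported_in V d &
   t ^+ 2 * 2 ^+ k <= rn (op d xi) ^+ 2].
have goodCc V d k : V `<=` W -> good V d k -> Cc (rdiag d).
  move=> VW [dc _ [K [cK KV dK]] _]; apply: rdiag_Cc => //.
  by exists K; split=> // g /KV/VW/Wu.
have step k V : open V -> V !=set0 -> V `<=` W -> exists d, good V d k.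
  elim: k V => [|k IH] V oV [u Vu] VW.
    have [d [dc d01 du [K [cK KV dK]]]] := bump_function R oV Vu.
    exists d; split=> //; first by exists K.
    rewrite expr0 mulr1 ler_pXn2r ?nnegrE ?rn_ge0 ?(ltW t0)//.
    apply: (key u) => //; first exact: VW.
    by apply: rdiag_Cc => //; exists K; split=> // g /KV/VW/Wu.
  have [v Vv vu] : exists2 v, V v & v != u.
    apply: contrapT => nv; apply: (Wni u (VW _ Vu)).
    rewrite (_ : [set u] = V)//; apply/seteqP; split=> [_ ->//|v Vv].
    by apply: contrapT => /eqP vu; apply: nv; exists v.
  have := @etale_hausdorff G; rewrite open_hausdorff => /(_ v u vu).
  move=> [[B C]/= [+ +] [oB oC /eqP BC]]; rewrite !inE => Bv Cu.
  have [d1 g1] := IH (V `&` B) (openI oV oB) (ex_intro _ v (conj Vv Bv)) (subset_trans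
    (@subIsetl _ _ _) VW).
  have [d2 g2] := IH (V `&` C) (openI oV oC) (ex_intro _ u (conj Vu Cu)) (subset_trans
    (@subIsetl _ _ _) VW).
  have hd1 := goodCc _ _ _ (subset_trans (@subIsetl _ _ _) VW) g1.
  have hd2 := goodCc _ _ _ (subset_trans (@subIsetl _ _ _) VW) g2.
  case: g1 => d1c d101 [K1 [cK1 K1V dK1]] h1;
    case: g2 => d2c d201 [K2 [cK2 K2V dK2]] h2.
  have d12 g : d1 g * d2 g = 0.
    apply/eqP; rewrite mulf_eq0; apply: contrapT => /negP; rewrite negb_or.
    move=> /andP[/dK1/K1V[_ Bg] /dK2/K2V[_ Cg]].
    by have : (B `&` C) g by []; rewrite BC.
  exists (fun g => 1 * d1 g + d2 g); split.
  - move=> g; apply: cvgD; last exact: d2c.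
    by apply: cvgM; [exact: cvg_cst|exact: d1c].
  - move=> g; rewrite mul1r; have /andP[a1 b1] := d101 g; have /andP[a2 b2] := d201 g.
    have /eqP := d12 g; rewrite mulf_eq0 => /orP[] /eqP ->; rewrite ?add0r ?addr0;
      exact/andP.
  - exists (K1 `|` K2); split; first exact: compactU.
      by move=> g [/K1V[]|/K2V[]].
    move=> g; rewrite mul1r; have [->|] := eqVneq (d1 g) 0; last by move=> /dK1; left.
    by rewrite add0r => /dK2; right.
  rewrite op_lin// scale1r pythagoras.
    by rewrite [2 ^+ k.+1]exprS mulrCA mulr_natl mulr2n lerD.
  rewrite -op_self// opM// (_ : (fun g => _) = fun=> 0) ?op0 ?inner0l//.
  by apply/funext => g; rewrite mulrC d12.
have bnd k : t ^+ 2 * 2 ^+ k <= rn xi ^+ 2.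
  have [d [dc d01 [K [cK KV dK]] hk]] := step k W oW (ex_intro _ _ Wx0) (@subset_refl _
    _).
  apply: (le_trans hk); rewrite ler_pXn2r ?nnegrE ?rn_ge0//.
  by apply: op_contraction => //; exists K; split=> // g /KV/Wu.
have t2 : 0 < t ^+ 2 by rewrite exprn_gt0.
have [k hk] : exists k, rn xi ^+ 2 / t ^+ 2 < k%:R.
  by exists (Num.truncn (rn xi ^+ 2 / t ^+ 2)).+1; rewrite truncnS_gt.
have := bnd k; rewrite mulrC -ler_pdivlMr// => /le_lt_trans/(_ hk).
by rewrite -natrX ltr_nat ltnNge ltnW// ltn_expl.
Qed.

End Isomorphism.


(** * The corner at an isolated unit and its trace *)

Section Corner.
Variables (R : realType) (G : etaleGroupoidType) (E : twist R G).
Variable A : reduced_cstar_algebra E.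
Local Notation q := (@twist_q R G E).
Local Notation iota := (@twist_iota R G E).
Local Notation rep := (@twist_rep R G E).
Local Notation cm := (completion_map A).
Variable u : G.
Hypotheses (hu : gunits u) (ou : open [set u]).
Implicit Types (x y : E) (v g : G) (f h : E -> R[i]) (a b : A).

Let p : A := cm (@rdiag R G E (unit_mass R u)).

Lemma unit_massZ v g (c : R[i]) : (unit_mass R v g)%:C * c = if g == v then c else 0.
Proof. by rewrite /unit_mass; case: eqP => _; rewrite ?mul1r ?mul0r. Qed.

Definition corner_supported f := forall x, f x != 0 ->
  grng (q x) = u /\ gsrc (q x) = u.

(** The source map is injective near [g]. Hence the corner lives on a discrete isotropy group. *)
Lemma isolated_src g : gsrc g = u -> open [set g].
Proof.
move=> sg; have [U [oU Ug inj]] := local_homeo_injective (@gsrc_local_homeo G) g.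
rewrite (_ : [set g] = U `&` gsrc @^-1` [set u]).
  by apply: openI => //; apply: open_comp => // ? _; exact: gsrc_continuous.
by apply/seteqP; split=> [_ ->//|g' [Ug' /= sg']]; apply: inj => //; rewrite sg.
Qed.

Lemma unit_mass_corner_Cc v w f : open [set v] -> open [set w] -> Cc f ->
  Cc (fun x => if (grng (q x) == v) && (gsrc (q x) == w) then f x else 0).
Proof.
move=> ov ow hf.
have c1 := real_complex_comp_continuous (@unit_mass_continuous R _ _ ov).
have c2 := real_complex_comp_continuous (@unit_mass_continuous R _ _ ow).
have := convolution_diagl_Cc c1 (convolution_diagr_Cc c2 hf); congr Cc.
apply/funext => x; rewrite convolution_diagl.
  rewrite convolution_diagr; last by case: hf.
  by rewrite unit_massZ [f x * _]mulrC unit_massZ; case: eqP.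
by case: (convolution_diagr_Cc c2 hf).
Qed.

Lemma cm_corner v w f : gunits v -> gunits w -> open [set v] -> open [set w] -> Cc f ->
  cmul (cm (@rdiag R G E (unit_mass R v))) (cmul (cm f) (cm (@rdiag R G E (unit_mass R
    w)))) =
  cm (fun x => if (grng (q x) == v) && (gsrc (q x) == w) then f x else 0).
Proof.
move=> hv hw ov ow hf.
have c1 := real_complex_comp_continuous (@unit_mass_continuous R _ _ ov).
have c2 := real_complex_comp_continuous (@unit_mass_continuous R _ _ ow).
have hr := convolution_diagr_Cc c2 hf.
have pv := @unit_mass_Cc R G E _ hv ov; have pw := @unit_mass_Cc R G E _ hw ow.
rewrite -(completion_map_mul A hf pw) -(completion_map_mul A pv hr).
congr cm; apply/funext => x; rewrite convolution_diagl; last by case: hr.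
rewrite convolution_diagr; last by case: hf.
by rewrite unit_massZ [f x * _]mulrC unit_massZ; case: eqP.
Qed.

Lemma unit_mass_projection v : gunits v -> open [set v] ->
  let pv := cm (@rdiag R G E (unit_mass R v)) in cstar pv = pv /\ cmul pv pv = pv.
Proof.
move=> hv ov; have hd := @unit_mass_Cc R G E _ hv ov; split; first exact: rdiag_star.
rewrite rdiagM//; congr cm; congr (@rdiag R G E); apply/funext => g.
by rewrite /unit_mass; case: eqP => _; rewrite ?mulr1 ?mulr0.
Qed.

(** Cutting an approximant on both sides by [p] fixes [a] and does not increase the distance, as
    [rn p <= 1]. *)
Lemma corner_dense a (e : R) : cmul p (cmul a p) = a -> 0 < e ->
  exists f, [/\ Cc f, corner_supported f & rn (a - cm f) < e].
Proof.
move=> pap e0; have [f hf af] := cm_dense a e0.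
exists (fun x => if (grng (q x) == u) && (gsrc (q x) == u) then f x else 0); split.
- exact: unit_mass_corner_Cc.
- by move=> x; case: ifP => [/andP[/eqP-> /eqP->]//|]; rewrite eqxx.
rewrite -cm_corner// -{1}pap -cmulBr -cmulBl -/p.
have p1 : rn p <= 1 by have [ps pp] := unit_mass_projection hu ou; exact: rn_projection.
apply: le_lt_trans af; apply: (le_trans (rn_cmul _ _)).
rewrite -[leRHS]mul1r; apply: ler_pM => //; rewrite ?rn_ge0//.
apply: (le_trans (rn_cmul _ _)).
by rewrite -[leRHS]mulr1; apply: ler_pM => //; rewrite ?rn_ge0.
Qed.

(** For [f] supported in the corner, this is the canonical trace of the twisted isotropy group
    algebra, taken at the product of [f] and its adjoint. *)
Definition trace_form f : R[i] := convolution f (involution f) (iota u 1).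

Lemma iota_unit_q : q (iota u 1) = u.
Proof. by rewrite twist_q_iota//; exact: circle1. Qed.

Lemma inv_rep_unit g : grng g = u ->
  gmul (ginv (rep g)) (iota u 1) = ginv (rep g).
Proof.
move=> rg; rewrite (_ : iota u 1 = gsrc (ginv (rep g))) ?gmul_src//.
by rewrite gsrc_inv grngE twist_repK rg.
Qed.

Lemma trace_formE f : trace_form f =
  \sum_(g \in [set g | grng g = u]) (rn (f (rep g)) ^+ 2)%:C.
Proof.
rewrite /trace_form /convolution iota_unit_q grng_unit//.
apply: eq_fsbigr => g; rewrite inE/= => rg.
by rewrite inv_rep_unit// /involution ginvK mul_conj.
Qed.

Lemma corner_star_supported f : corner_supported f -> corner_supported (involution f).
Proof.
move=> cf x; rewrite /involution fmorph_eq0 => /cf.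
by rewrite q_inv grng_inv gsrc_inv => -[].
Qed.

Lemma involutionK f : involution (involution f) = f.
Proof. by apply/funext => x; rewrite /involution ginvK conjCK. Qed.

(** The product is supported over quotients of finitely many arrows, and all of these quotients with
    source [u] are isolated. *)
Lemma corner_mul_star_Cc f : Cc f -> corner_supported f ->
  Cc (convolution f (involution f)).
Proof.
move=> hf cf; pose S := [set g | grng g = u /\ f (rep g) != 0].
have fS : finite_set S by exact: Cc_finite_range.
have fe : equivariant f by case: hf.
apply: (@isolated_Cc _ _ _ _ ([set gmul a (ginv b) | a in S & b in S] `&` [set g | gsrc
  g = u])).
- apply: finite_setIl; exact: finite_image2.
- by move=> g [_ /= sg]; exact: isolated_src.
- exact/convolution_equivariant/involution_equivariant.
move=> x cx.
have [g [rg fg hg]] : exists g, [/\ grng g = grng (q x), f (rep g) != 0 &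
    involution f (gmul (ginv (rep g)) x) != 0].
  apply: contrapT => /forallNP ng; move: cx;
    rewrite /convolution fsbig1 ?eqxx// => g rg.
  apply/eqP; rewrite mulf_eq0; apply: contrapT => /negP;
    rewrite negb_or => /andP[h1 h2].
  by apply: (ng g).
have [] := cf _ fg; rewrite !twist_repK => ru su.
have := corner_star_supported cf hg; rewrite q_rep_mul// => -[r2 s2].
have sx : gsrc (q x) = u by rewrite -s2 gsrc_mul// gsrc_inv.
split=> //; exists g; first by [].
exists (gmul (ginv (q x)) g); last first.
  by rewrite ginv_mul ?gsrc_inv// ginvK gmulVK.
split; first by rewrite grng_mul ?gsrc_inv// grng_inv.
move: hg; rewrite /involution fmorph_eq0.
rewrite (equivariant_neq0 fe (y := rep (gmul (ginv (q x)) g)))//.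
by rewrite twist_repK q_inv q_rep_mul// ginv_mul ?gsrc_inv// ginvK.
Qed.

(** The sum of squares runs over the isotropy group at [u], which inversion permutes. *)
Lemma trace_form_star f : Cc f -> corner_supported f ->
  trace_form (involution f) = trace_form f.
Proof.
move=> hf cf; rewrite !trace_formE.
have fe : equivariant f by case: hf.
pose D := [set g | grng g = u /\ gsrc g = u].
have restr h : corner_supported h ->
    \sum_(g \in [set g | grng g = u]) (rn (h (rep g)) ^+ 2)%:C =
    \sum_(g \in D) (rn (h (rep g)) ^+ 2)%:C.
  move=> ch; rewrite -(@fsbig_widen _ _ _ _ D)//; first by move=> g [].
  move=> g [/= rg nD]; have [->|/ch] := eqVneq (h (rep g)) 0.
    by rewrite rn0 expr0n.
  by rewrite twist_repK.
rewrite !restr//; last exact: corner_star_supported.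
rewrite [RHS](@reindex_fsbig _ _ _ _ _ ginv D); last first.
  split; first by move=> g [rg sg]; split; rewrite ?grng_inv ?gsrc_inv.
    by move=> g h _ _ /(congr1 ginv); rewrite !ginvK.
  move=> g [rg sg]; exists (ginv g); last exact: ginvK.
  by split; rewrite /= ?grng_inv ?gsrc_inv.
apply: eq_fsbigr => g _; rewrite /involution rn_conj.
by rewrite (equivariant_rn fe (y := rep (ginv g)))// q_inv !twist_repK.
Qed.

Lemma trace_form_ge f x : Cc f -> corner_supported f ->
  rn (f x) ^+ 2 <= rn (trace_form f).
Proof.
move=> hf cf; have fe : equivariant f by case: hf.
have /finite_seqP[s0 Ss0] := Cc_finite_range u hf.
pose s := undup s0.
have Ss : [set g | grng g = u /\ f (rep g) != 0] = [set` s].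
  by rewrite Ss0; apply/seteqP; split=> g /=; rewrite mem_undup.
have -> : trace_form f = (\sum_(g <- s) rn (f (rep g)) ^+ 2)%:C.
  rewrite trace_formE rmorph_sum/= (fsbig_seq _ _ (undup_uniq s0)) -Ss.
  apply/esym/fsbig_widen => [g []//|g [/= rg nf]].
  have [->|fg] := eqVneq (f (rep g)) 0; first by rewrite rn0 expr0n.
  by exfalso; apply: nf.
have S0 : 0 <= \sum_(g <- s) rn (f (rep g)) ^+ 2.
  by apply: sumr_ge0 => g _; exact: sqr_ge0.
rewrite rn_real ger0_norm//.
have [->|fx] := eqVneq (f x) 0; first by rewrite rn0 expr0n.
have [rx _] := cf x fx.
have xs : q x \in s.
  have : [set g | grng g = u /\ f (rep g) != 0] (q x).
    by split=> //; rewrite (equivariant_neq0 fe (y := x))// twist_repK.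
  by rewrite Ss.
rewrite (bigD1_seq (q x))//= ?undup_uniq//.
rewrite (equivariant_rn fe (y := rep (q x))) ?twist_repK//.
by rewrite lerDl; apply: sumr_ge0 => g _; exact: sqr_ge0.
Qed.

Lemma corner_trace_approx a (e : R) : cmul p (cmul a p) = a -> 0 < e ->
  exists f, [/\ Cc f, corner_supported f, rn (a - cm f) <= e,
    rn (ev (cmul a (cstar a)) (iota u 1) - trace_form f) <= (2 * rn a + 1) * e &
    rn (ev (cmul (cstar a) a) (iota u 1) - trace_form f) <= (2 * rn a + 1) * e].
Proof.
(* The cap at 1 absorbs the quadratic error [t * t] into a linear one. *)
move=> pap e0; pose t := Num.min e 1.
have t0 : 0 < t by rewrite lt_min e0 ltr01.
have [te t1] : t <= e /\ t <= 1 by rewrite !ge_min !lexx orbT.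
have [f [hf cf /ltW aft]] := corner_dense pap t0.
have hs := involution_Cc hf; have cs := corner_star_supported cf.
have naf : rn (cm f) <= rn a + t.
  by have := rnD (cm f - a) a; rewrite subrK (rn_distC (cm f)); lra.
have bnd : rn a * rn (a - cm f) + rn (a - cm f) * rn (cm f) <= (2 * rn a + 1) * e.
  have h1 := ler_wpM2l (rn_ge0 a) aft.
  have h2 := ler_pM (rn_ge0 (a - cm f)) (rn_ge0 (cm f)) aft naf.
  have h3 : (2 * rn a + 1) * t <= (2 * rn a + 1) * e.
    by rewrite ler_wpM2l// addr_ge0// mulr_ge0// rn_ge0.
  have h4 : t * t <= t by rewrite ler_piMr// ltW.
  by lra.
exists f; split=> //; first exact: le_trans te.
- have hc := corner_mul_star_Cc hf cf.
  rewrite (le_trans (evP _ _ hc))// completion_map_mul// completion_map_star//.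
  by rewrite (le_trans (rn_cmulB _ _ _ _))// -cstarB !rn_cstar.
- rewrite -trace_form_star// /trace_form involutionK.
  have hc := corner_mul_star_Cc hs cs; rewrite involutionK in hc.
  rewrite (le_trans (evP _ _ hc))// completion_map_mul// completion_map_star//.
  by rewrite (le_trans (rn_cmulB _ _ _ _))// -cstarB !rn_cstar.
Qed.

Lemma corner_trace a : cmul p (cmul a p) = a ->
  ev (cmul a (cstar a)) (iota u 1) = ev (cmul (cstar a) a) (iota u 1).
Proof.
move=> pap; apply: (@eq_rn_lim _ _ (2 * (2 * rn a + 1))) => e e0.
have [f [_ _ _ h1 h2]] := corner_trace_approx pap e0.
rewrite (le_trans (rn_triangle (trace_form f) _ _))// -mulrA mulr_natl mulr2n.
by rewrite lerD// rn_distC.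
Qed.

Lemma corner_trace_faithful a : cmul p (cmul a p) = a ->
  ev (cmul a (cstar a)) (iota u 1) = 0 -> a = 0.
Proof.
move=> pap a0; apply: ev_faithful => x.
(* The trace controls [|f x|^2], so the limit is taken on squares; the summand 2 in the constant
   pays for the squared approximation error. *)
have : ev a x ^+ 2 = 0.
  apply: (@eq_rn_lim _ _ (2 * (2 * rn a + 1) + 2)) => e e0; rewrite subr0.
  have t0 : 0 < Num.min e 1 by rewrite lt_min e0 ltr01.
  have [te t1] : Num.min e 1 <= e /\ Num.min e 1 <= 1 by rewrite !ge_min !lexx orbT.
  move: (Num.min e 1) t0 te t1 => t t0 te t1.
  have [f [hf cf af h1 _]] := corner_trace_approx pap t0.
  move: h1; rewrite a0 sub0r rnN => h1.
  have h2 := le_trans (trace_form_ge x hf cf) h1.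
  have h3 := le_trans (evP a x hf) af.
  have := rn_sqrD (ev a x - f x) (f x); rewrite subrK expr2 rnM -expr2.
  have := rn_ge0 (ev a x - f x); have := rn_ge0 a.
  by move: (rn (ev a x - f x)) h3 => r; nra.
by move=> /eqP; rewrite expf_eq0 => /eqP.
Qed.

End Corner.


(** * Projections at isolated units and the contradiction *)

Section IsolatedUnits.
Variables (R : realType) (H : hilbertType R) (G : etaleGroupoidType).
Variables (E : twist R G) (A : reduced_cstar_algebra E).
Variables (phi : {linear bounded_operator H -> A}) (psi : A -> bounded_operator H).
Hypotheses (phiK : cancel phi psi) (psiK : cancel psi phi)
  (phiM : forall S T : bounded_operator H, phi (cmul S T) = cmul (phi S) (phi T))
  (phiS : forall T : bounded_operator H, phi (cstar T) = cstar (phi T)).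
Local Notation q := (@twist_q R G E).
Local Notation iota := (@twist_iota R G E).
Local Notation cm := (completion_map A).
Local Notation rdiag := (@rdiag R G E).
Implicit Types (x y : E) (u v g : G) (f h : E -> R[i]).
Implicit Types (a b : A) (xi eta : H).

Definition isolated : set G := [set u | gunits u /\ open [set u]].

Definition proj u : bounded_operator H := @op R H G E A psi (unit_mass R u).

Let phi_inj : injective phi := can_inj phiK.

Lemma isolated_Cc_mass u : isolated u -> Cc (rdiag (unit_mass R u)).
Proof. by move=> [hu ou]; exact: unit_mass_Cc. Qed.

Lemma phi_proj u : phi (proj u) = cm (rdiag (unit_mass R u)).
Proof. exact: psiK. Qed.

Lemma proj_self u xi eta : isolated u -> inner (proj u xi) eta = inner xi (proj u eta).
Proof.
by move=> iu; apply: (op_self phiK psiK phiS); exact: isolated_Cc_mass.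
Qed.

Lemma proj_star u : isolated u -> cstar (proj u) = proj u.
Proof.
by move=> iu; apply: (op_star phiK psiK phiS); exact: isolated_Cc_mass.
Qed.

Lemma proj_proj u v xi : isolated u -> isolated v ->
  proj u (proj v xi) = if u == v then proj v xi else 0.
Proof.
move=> iu iv; rewrite /proj (opM phiK psiK phiM); try exact: isolated_Cc_mass.
case: eqP => [->|uv].
  congr (op _ _ _); apply/funext => g.
  by rewrite /unit_mass; case: eqP => _; rewrite ?mulr1 ?mulr0.
rewrite (_ : (fun g => _) = fun=> 0) ?(op0 phiK psiK)//.
apply/funext => g; rewrite /unit_mass; case: eqP => [->|_]; last by rewrite mul0r.
by case: eqP => // _; rewrite mulr0.
Qed.

Lemma proj_id u xi : isolated u -> proj u (proj u xi) = proj u xi.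
Proof. by move=> iu; rewrite proj_proj// eqxx. Qed.

Lemma proj_orth u v xi eta : isolated u -> isolated v -> u != v ->
  proj u xi = xi -> proj v eta = eta -> inner xi eta = 0.
Proof.
move=> iu iv uv <- <-; rewrite proj_self// proj_proj//.
by rewrite (negbTE uv) inner0r.
Qed.

Lemma proj_other u v xi : isolated u -> isolated v -> u != v ->
  proj v xi = xi -> proj u xi = 0.
Proof. by move=> iu iv uv <-; rewrite proj_proj// (negbTE uv). Qed.

(** This is the statement that the projections sum to 1, in a form that involves no convergence. *)
Lemma proj_total xi : (forall u, isolated u -> proj u xi = 0) -> xi = 0.
Proof.
move=> h; apply/eqP/negP => /negP xi0.
have [u [hu ou]] := exists_isolated phiK psiK phiM phiS xi0.
by move/eqP; apply; exact: h.
Qed.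

(** The point mass at [u] has value 1 at [iota u 1], so its operator cannot vanish. *)
Lemma proj_neq0 u : isolated u -> exists2 xi, proj u xi = xi & rn xi = 1.
Proof.
move=> iu; have [hu ou] := iu.
have [xi pxi] : exists xi, proj u xi != 0.
  apply: contrapT => /forallNP h.
  have p0 : proj u = 0 by apply: bo_eqP => xi; apply/eqP/negP => /negP; exact: h.
  have := ev_cm A (iota u 1) (isolated_Cc_mass iu).
  rewrite -phi_proj p0 linear0 -(cm0 A) ev_cm; last exact: Cc0.
  rewrite /rdiag diag_iota//; last exact: circle1.
  rewrite /unit_mass eqxx mul1r => /eqP.
  by rewrite eq_sym oner_eq0.
exists ((rn (proj u xi))^-1%:C *: proj u xi); last exact: rn_normalize.
by rewrite linearZ/= proj_id.
Qed.

Lemma rank_one_corner u xi eta : isolated u -> proj u xi = xi -> proj u eta = eta ->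
  let p := cm (rdiag (unit_mass R u)) in
  cmul p (cmul (phi (rank_one xi eta)) p) = phi (rank_one xi eta).
Proof.
move=> iu hxi heta /=; rewrite -phi_proj -!phiM; congr (phi _).
have := rank_one_mul_adj (proj u) xi eta; rewrite proj_star// => ->.
by rewrite mul_rank_one hxi heta.
Qed.

Lemma projection_sum (I : finType) (P : pred I) (e : I -> bounded_operator H) :
  (forall i, cstar (e i) = e i) ->
  (forall i j, cmul (e i) (e j) = if i == j then e i else 0) ->
  rn (phi (\sum_(i | P i) e i)) <= 1.
Proof.
move=> es ee.
have sumE (r : seq I) (Q : pred I) xi : (\sum_(i <- r | Q i) e i : bounded_operator H)
  xi =
    \sum_(i <- r | Q i) e i xi.
  by elim/big_rec2: _ => // i x y _ <-.
apply: (phi_projection phiM phiS).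
  elim/big_rec: _ => [|i x _ h]; last by rewrite cstarD es h.
  by have := cstarB (0 : bounded_operator H) 0; rewrite !subrr.
apply: bo_eqP => xi; rewrite cmulE !sumE; apply: eq_bigr => i Pi.
rewrite linear_sum (bigD1 i)//= -cmulE ee eqxx big1 ?addr0// => j /andP[_ ji].
by rewrite -cmulE ee eq_sym (negbTE ji).
Qed.

(* The evaluation at the unit is a faithful trace on the corner, hence takes
   the same nonzero value on all rank one projections below [proj u]. *)
Lemma corner_finitely_spanned u : isolated u ->
  finitely_spanned [set xi | proj u xi = xi].
Proof.
move=> iu; have [hu ou] := iu.
pose K := [set xi | proj u xi = xi].
have Klin (c : R[i]) xi eta : K xi -> K eta -> K (c *: xi + eta).
  by rewrite /K/= => h1 h2; rewrite linearP/= h1 h2.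
have K0 : K 0 by rewrite /K/= linear0.
have [xi0 Kxi0 nxi0] := proj_neq0 iu.
pose J xi := ev (phi (rank_one xi xi)) (iota u 1).
have unit_star xi eta : rn eta = 1 -> phi (rank_one xi xi) =
    cmul (phi (rank_one xi eta)) (cstar (phi (rank_one xi eta))).
  move=> neta; rewrite -phiS -phiM rank_one_star rank_one_mul -rn_sqr neta.
  by rewrite expr1n scale1r.
have star_unit xi eta : rn xi = 1 -> phi (rank_one eta eta) =
    cmul (cstar (phi (rank_one xi eta))) (phi (rank_one xi eta)).
  move=> nxi; rewrite -phiS -phiM rank_one_star rank_one_mul -rn_sqr nxi.
  by rewrite expr1n scale1r.
(* With [a] the image of [rank_one xi xi0], the two rank one projections are [a a*] and [a* a],
   which have the same trace. *)
have JE xi : K xi -> rn xi = 1 -> J xi = J xi0.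
  move=> Kxi nxi; rewrite /J (unit_star xi xi0 nxi0) (star_unit xi xi0 nxi).
  by apply: corner_trace => //; exact: rank_one_corner.
have J0 : 0 < rn (J xi0).
  rewrite lt_neqAle rn_ge0 eq_sym rn_eq0 andbT; apply/eqP => h.
  have e0 : phi (rank_one xi0 xi0) = 0.
    apply: (corner_trace_faithful hu ou); first exact: rank_one_corner.
    by rewrite -unit_star.
  have := phi_rank_one phi_inj phiM phiS xi0 xi0.
  by rewrite e0 rn0 nxi0 mulr1 => /eqP; rewrite eq_sym oner_eq0.
(* With this [m], a projection of rank [m] below [proj u] would have an evaluation of modulus
   [m * rn (J xi0) > 1], although its image has norm at most 1. *)
have [m hm] : exists m : nat, 1 / rn (J xi0) < m%:R.
  by exists (Num.truncn (1 / rn (J xi0))).+1; rewrite truncnS_gt.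
have [[e oe Ke]|//] := orthonormal_or_spanned m Klin K0; exfalso.
have ee (i j : 'I_m) : inner (e i) (e j) = (i == j)%:R by rewrite oe.
have ne (i : 'I_m) : rn (e i) = 1.
  have := ee i i; rewrite -rn_sqr eqxx => h.
  apply/eqP; rewrite -(@eqrXn2 _ 2) ?rn_ge0// expr1n.
  by apply/eqP/(@complexI R); rewrite h.
have := @projection_sum _ xpredT (fun i : 'I_m => rank_one (e i) (e i)).
move=> /(_ (fun i => rank_one_star _ _)) h.
have {}h : rn (phi (\sum_(i < m) rank_one (e i) (e i))) <= 1.
  apply: h => i j; rewrite rank_one_mul ee eq_sym.
  by case: eqP => [->|_]; rewrite ?scale1r ?scale0r.
have := le_trans (ev_le (phi (\sum_(i < m) rank_one (e i) (e i))) (iota u 1)) h.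
rewrite linear_sum ev_sum (eq_bigr (fun=> J xi0)); last first.
  by move=> i _; apply: JE; [exact: Ke|exact: ne].
rewrite sumr_const card_ord -mulr_natl rnM.
by rewrite rn_nat leNgt -ltr_pdivrMr// hm.
Qed.

(** With finitely many isolated units, [proj_total] would make every vector the sum of its
    projections, each in a finitely spanned space. *)
Lemma isolated_infinite : infinite_dimensional H -> infinite_set isolated.
Proof.
move=> infH /finite_seqP[s0 s0E]; pose s := undup s0.
have sE u : (u \in s) = `[< isolated u >] by rewrite mem_undup s0E; apply/idP/asboolP.
have iso u : u \in s -> isolated u by rewrite sE => /asboolP.
have sum_proj xi : xi = \sum_(u <- s) proj u xi.
  apply/eqP; rewrite -subr_eq0; apply/eqP; apply: proj_total => v iv.
  have vs : v \in s by rewrite sE; exact/asboolP.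
  rewrite linearB linear_sum (bigD1_seq v)//= ?undup_uniq// proj_id//.
  rewrite big_seq_cond big1 ?addr0 ?subrr// => w /andP[ws wv].
  by rewrite proj_proj ?[v == w]eq_sym ?(negbTE wv)//; exact: iso.
have span (r : seq G) : {subset r <= s} ->
    finitely_spanned [set \sum_(u <- r) proj u xi | xi in [set: H]].
  elim: r => [|u r IH] rs.
    by exists 0%N, (fun=> 0) => _ [xi _ <-]; exists (fun=> 0); rewrite big_nil big_ord0.
  have us : u \in s by apply: rs; rewrite mem_head.
  have [|n [e he]] := finitely_spannedD (corner_finitely_spanned (iso _ us)) (IH _).
    by move=> w wr; apply: rs; rewrite inE wr orbT.
  exists n, e => _ [xi _ <-]; apply: he; exists (proj u xi).
    by rewrite /= proj_id//; exact: iso.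
  by exists (\sum_(w <- r) proj w xi); [exists xi|rewrite big_cons].
have [n [e he]] := span s (fun _ => id).
apply: infH; exists n, (fun i : 'I_n => e i) => xi.
have [|c ->] := he xi; first by exists xi => //; rewrite -sum_proj.
by exists (fun i : 'I_n => c i).
Qed.

(* Each fibre of the source map meets the support of [f] in at most [N] points. *)
Lemma sparse_blocks f : Cc f -> exists N : nat,
  forall (n : nat) (w : 'I_n -> G) v, injective w -> (forall i, isolated (w i)) ->
  isolated v -> exists B : {set 'I_n}, (#|B| <= N)%N /\
    forall i, i \notin B -> cmul (phi (proj (w i))) (cmul (cm f) (phi (proj v))) = 0.
Proof.
move=> hf; have [N [U [h1 h2]]] := bisection_cover (@gsrc_local_homeo G) hf.
exists N => n w v winj iw iv.
pose hit i k x := [/\ f x != 0, grng (q x) = w i, gsrc (q x) = v & U k (q x)].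
pose bad i := exists x, [/\ f x != 0, grng (q x) = w i & gsrc (q x) = v].
have /boolp.choice[k hk] : forall i, exists k, bad i -> (k < N)%N /\ exists x, hit i k
  x.
  move=> i.
  have [[x [fx rx sx]]|nb] := pselect (bad i); last by exists 0%N.
  have [k kN Uk] := h1 x fx.
  by exists k => _; split=> //; exists x.
exists [set i | `[< bad i >]]%SET; split; last first.
  move=> i; rewrite inE => /asboolPn nb.
  have [hwi owi] := iw i; have [hv ov] := iv.
  rewrite !phi_proj cm_corner// -[RHS](cm0 A); congr cm; apply/funext => x.
  case: ifP => // /andP[/eqP rx /eqP sx]; apply/eqP/negP => /negP fx.
  by apply: nb; exists x.
(* The map [k] is injective on bad rows: two arrows in the same [U k] with the common source [v]
   coincide, so their ranges agree. *)
rewrite cardE -(size_map k) -(size_iota 0 N); apply: uniq_leq_size.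
  rewrite map_inj_in_uniq ?enum_uniq// => i j; rewrite !mem_enum !inE.
  move=> bi bj kij; have [_ [x [_ rx sx Ux]]] := hk i bi.
  have [_ [y [_ ry sy Uy]]] := hk j bj.
  apply: winj; rewrite -rx -ry; congr (grng _).
  by apply: (h2 (k i)) => //; [rewrite kij|rewrite sx].
move=> _ /mapP[i + ->]; rewrite mem_enum !inE => bi; have [kN _] := hk i bi.
by rewrite mem_iota add0n.
Qed.

Lemma finite_dimensional : ~ infinite_dimensional H.
Proof.
move=> /isolated_infinite /infiniteP /pcard_surjP[k ksurj].
have /boolp.choice[u hu] : forall n, exists v, isolated v /\ k v = n.
  by move=> n; have [v iv kv] := ksurj n I; exists v.
have iu n : isolated (u n) by case: (hu n).
have uinj : injective u by move=> n m /(congr1 k); rewrite !(hu _).2.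
have /boolp.choice[e he] : forall n, exists xi, proj (u n) xi = xi /\ rn xi = 1.
  by move=> n; have [xi h1 h2] := proj_neq0 (iu n); exists xi.
have eP n : proj (u n) (e n) = e n by case: (he n).
have eo n m : inner (e n) (e m) = (n == m)%:R.
  have [->|nm] := eqVneq n m; first by rewrite -rn_sqr; case: (he m) => _ ->;
    rewrite expr1n.
  apply: (proj_orth (iu n) (iu m)) => //.
  by apply: contra_neq nm; exact: uinj.
(* Pairs cut the basis into disjoint infinite blocks. The column of [T] at [f n] stays in block [n],
   so different columns are orthogonal. *)
pose ix (n i : nat) : nat := pickle (n, i).
have ixE n i m j : (ix n i == ix m j) = (n == m) && (i == j).
  by rewrite /ix (inj_eq (pcan_inj pickleK)) xpair_eqE.
pose r (n : nat) : R := (Num.sqrt n.+1%:R)^-1.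
have r2 n : r n ^+ 2 = n.+1%:R^-1 by rewrite exprVn sqr_sqrtr.
have oE n : orthonormal_upto (fun i => e (ix n i)) n.+1.
  by move=> i j _ _; rewrite eo ixE eqxx.
pose f n := e (ix n 0%N).
pose w n := \sum_(i < n.+1) (r n)%:C *: e (ix n i).
have [T Tf] : exists T : bounded_operator H, forall n, T (f n) = w n.
  apply: orthonormal_transfer => N n m _ _.
    by rewrite eo ixE eqxx andbT.
  have [->|nm] := eqVneq n m.
    rewrite -rn_sqr (rn_orthonormal_sum (fun=> (r m)%:C) (oE m)) rn_real.
    rewrite sumr_const card_ord real_normK ?num_real// r2 -[_ *+ m.+1]mulr_natl.
    by rewrite mulfV// pnatr_eq0.
  rewrite /w inner_suml big1// => i _; rewrite inner_sumr big1// => j _.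
  by rewrite innerZl innerZr eo ixE (negbTE nm) !mulr0.
have half0 : 0 < 2^-1 :> R by rewrite invr_gt0.
have [g hg Tg] := cm_dense (phi T) half0.
have [N hN] := sparse_blocks hg.
(* Column [n] then has [2 N + 1] entries, of which at least [N + 1] survive outside [B]: a squared
   norm of at least [(N + 1) / (2 N + 1)], above the [1 / 4] allowed by an approximation within
   [1 / 2]. *)
pose n := (2 * N)%N.
have uix_inj : injective (fun i : 'I_n.+1 => u (ix n i)).
  by move=> i j /uinj/eqP; rewrite ixE eqxx => /eqP; exact: val_inj.
have [B [BN hB]] := hN n.+1 _ (u (ix n 0%N)) uix_inj (fun i => iu _) (iu _).
(* [P] keeps the rows of the block that [g] misses and [Q] selects the column, so compressing by
   them kills [g] but not [T]. *)
pose P := \sum_(i < n.+1 | i \notin B) proj (u (ix n i)).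
pose Q := rank_one (f n) (f n).
have P1 : rn (phi P) <= 1.
  apply: projection_sum => [i|i j]; first exact: proj_star.
  apply: bo_eqP => xi; rewrite cmulE proj_proj// (inj_eq uinj) ixE eqxx/=.
  rewrite -val_eqE; case: eqP => [->//|_].
  by [].
have nf : rn (f n) = 1 by case: (he (ix n 0%N)).
have Q1 : rn (phi Q) = 1.
  by rewrite (phi_rank_one phi_inj phiM phiS) nf mulr1.
have PE xi : P xi = \sum_(i < n.+1 | i \notin B) proj (u (ix n i)) xi.
  by rewrite /P; elim/big_rec2: _ => // i x y _ <-.
have PgQ : cmul (phi P) (cmul (cm g) (phi Q)) = 0.
  have -> : Q = cmul (proj (u (ix n 0%N))) Q.
    by rewrite /Q mul_rank_one eP.
  rewrite phiM /P linear_sum.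
  have : forall (I : Type) (s : seq I) (D : pred I) (F : I -> A) (b : A),
      cmul (\sum_(i <- s | D i) F i) b = \sum_(i <- s | D i) cmul (F i) b.
    move=> I s D F b; elim/big_rec2: _ => [|i x y _ <-]; first exact: cmul0l.
    exact: cmulDl.
  move=> ->; rewrite big1// => i iB.
  by rewrite [cmul (cm g) _]cmulA cmulA hB// cmul0l.
(* The coefficients of [rn_orthonormal_sum] are indexed by [nat]; [inord] recovers the ordinal
   needed to test membership in [B]. *)
pose c (i : nat) := if inord i \in B then 0 else r n.
have PTQ : cmul P (cmul T Q) = rank_one (\sum_(i < n.+1) (c i)%:C *: e (ix n i)) (f n).
  rewrite mul_rank_one Tf mul_rank_one; congr rank_one.
  rewrite PE big_mkcond; apply: eq_bigr => i _; rewrite /c inord_val.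
  case: (i \in B) => /=; first by rewrite scale0r.
  rewrite linear_sum (bigD1 i)//= linearZ/= eP big1 ?addr0// => j ji.
  rewrite linearZ/= (proj_other (iu _) (iu _) _ (eP _)) ?scaler0//.
  by rewrite (inj_eq uinj) ixE eqxx eq_sym.
have : rn (phi (cmul P (cmul T Q))) <= 2^-1.
  rewrite !phiM -[cmul _ _]subr0 -PgQ -cmulBr -cmulBl.
  apply: (le_trans (rn_cmul _ _)); rewrite -[leRHS]mul1r.
  apply: ler_pM => //; rewrite ?rn_ge0//; apply: (le_trans (rn_cmul _ _)).
  by rewrite Q1 mulr1 ltW.
rewrite PTQ (phi_rank_one phi_inj phiM phiS) nf mulr1.
rewrite -(@ler_pXn2r _ 2) ?nnegrE ?rn_ge0 ?(ltW half0)//.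
rewrite (rn_orthonormal_sum (fun i => (c i)%:C) (oE n)).
rewrite (eq_bigr (fun i => if i \notin B then n.+1%:R^-1 else 0)); last first.
  move=> i _; rewrite rn_real real_normK ?num_real// /c inord_val.
  by case: (i \in B); rewrite ?expr0n.
rewrite -big_mkcond sumr_const -[_ *+ #|_|]mulr_natl ler_pdivrMr ?ltr0n//.
have : (N.+1 <= #|[predC B]|)%N.
  rewrite -(leq_add2l #|B|) cardC card_ord addnS ltnS.
  by apply: (@leq_trans (N + N)); [rewrite leq_add2r|rewrite addnn -mul2n].
rewrite -(ler_nat R) /n => h1 h2.
have := le_trans h1 h2; rewrite -!natr1 natrM exprVn.
by have := ler0n R N; lra.
Qed.

End IsolatedUnits.

Theorem theorem1p1 (R : realType) (H : hilbertType R) :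
  infinite_dimensional H ->
  ~ exists (G : etaleGroupoidType) (E : twist R G)
           (A : reduced_cstar_algebra E),
      cstar_isomorphic (bounded_operator H) A.
Proof.
move=> infH [G [E [A [phi [[psi phiK psiK] phiM phiS]]]]].
exact: (finite_dimensional phiK psiK phiM phiS infH).
Qed.
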